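(* Let $Y$ be a separable reflexive Banach space with an unconditional asymptotic structure. Then $Y$ admits an equivalent asymptotically midpoint uniformly convex norm if and only if $Y$ admits an equivalent asymptotically uniformly convex norm.
   Context: $\mathrm{cof}(Y)$ denotes the set of (closed) finite-codimensional subspaces of $Y$, $S_Z$ the unit sphere of $Z$. Unconditional asymptotic structure: a finite sequence $(x_j)_{j=1}^n$ is $C$-unconditional if $\|\sum_j\epsilon_j a_jx_j\|\le C\|\sum_j a_jx_j\|$ for all scalars $a_j$ and signs $\epsilon_j=\pm1$. $Y$ has an unconditional asymptotic structure if there is $C\ge1$ such that for all $n\in\mathbb{N}$: $\exists Y_1\in\mathrm{cof}(Y)\ \forall x_1\in S_{Y_1}\ \ldots\ \exists Y_n\in\mathrm{cof}(Y)\ \forall x_n\in S_{Y_n}$, $(x_j)_{j=1}^n$ is $C$-unconditional. For $t\in(0,1)$ put $\bar\delta_Y(t):=\inf_{y\in S_Y}\sup_{Z\in\mathrm{cof}(Y)}\inf_{z\in S_Z}\|y+tz\|-1$ and $\tilde\delta_Y(t):=\inf_{y\in S_Y}\sup_{Z\in\mathrm{cof}(Y)}\inf_{z\in S_Z}\max\{\|y+tz\|,\|y-tz\|\}-1$. The norm is asymptotically uniformly convex if $\bar\delta_Y(t)>0$ for all $t\in(0,1)$, and asymptotically midpoint uniformly convex if $\tilde\delta_Y(t)>0$ for all $t\in(0,1)$. *)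

(* Defs.v *)
From HB Require Import structures.
From mathcomp Require Import all_boot all_order all_algebra.
From mathcomp Require Import all_classical all_reals all_analysis.

Set Implicit Arguments.
Unset Strict Implicit.
Unset Printing Implicit Defensive.

Import Order.TTheory GRing.Theory Num.Theory.
Import numFieldNormedType.Exports.

Local Open Scope classical_set_scope.
Local Open Scope ring_scope.

Definition separable (T : topologicalType) : Prop :=
  exists D : set T, countable D /\ dense D.

Section Reflexivity.
Variables (R : realType) (Y : normedModType R).

Definition topological_dual : set (Y -> R^o) := [set f | linear f /\ continuous f].

Definition dual_norm (f : Y -> R^o) : R :=
  sup [set `|f y| | y in [set y : Y | `|y| <= 1]].

(* A bidual element is encoded by a function Phi on all of Y -> R^o; only its
   values on the dual matter. *)
Definition bidual : set ((Y -> R^o) -> R) :=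
  [set Phi |
    (forall (a : R) (f g : Y -> R^o), topological_dual f -> topological_dual g ->
       Phi (a *: f + g) = a * Phi f + Phi g) /\
    (exists M : R, forall f, topological_dual f -> `|Phi f| <= M * dual_norm f)].

(* The canonical embedding of Y into its bidual is onto. *)
Definition reflexive_space : Prop :=
  forall Phi, bidual Phi -> exists y : Y, forall f, topological_dual f -> Phi f = f y.

End Reflexivity.

Section AsymptoticStructure.
Variables (R : realType) (Y : normedModType R).

(* The last clause says that Y / Z is spanned by finitely many classes. *)
Definition cof : set (set Y) :=
  [set Z |
    [/\ submod_closed [in Z], closed Z &
      exists (n : nat) (v : 'I_n -> Y), forall y : Y,
        exists (a : 'I_n -> R) (z : Y), Z z /\ y = z + \sum_(i < n) a i *: v i]].

Definition sphere (N : Y -> R) (Z : set Y) : set Y := [set z | Z z /\ N z = 1].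

Definition unconditional (C : R) (n : nat) (x : n.-tuple Y) : Prop :=
  forall (a : 'I_n -> R) (e : 'I_n -> bool),
    `|\sum_(j < n) ((-1) ^+ e j * a j) *: tnth x j|
      <= C * `|\sum_(j < n) a j *: tnth x j|.

(* exists Y_1 in cof Y, forall x_1 in S_{Y_1}, ...,
   exists Y_n in cof Y, forall x_n in S_{Y_n}, P (x_1, ..., x_n) *)
Fixpoint asymptotically (n : nat) : (n.-tuple Y -> Prop) -> Prop :=
  match n with
  | 0 => fun P => P [tuple]
  | m.+1 => fun P =>
      exists Z : set Y, cof Z /\
        forall x : Y, sphere Num.norm Z x ->
          asymptotically (fun s : m.-tuple Y => P [tuple of x :: s])
  end.

Definition unconditional_asymptotic_structure : Prop :=
  exists C : R, 1 <= C /\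
    forall n : nat, asymptotically (@unconditional C n).

Definition equivalent_norm (N : Y -> R) : Prop :=
  [/\ forall x y, N (x + y) <= N x + N y,
      forall (a : R) x, N (a *: x) = `|a| * N x &
      exists c C : R, [/\ 0 < c, 0 < C & forall x, c * `|x| <= N x <= C * `|x|]].

(* Moduli of the space (Y, N), for N an equivalent norm: the closed subspaces,
   hence cof Y, are then the same for N and for the norm of Y.  The infima and
   suprema are taken in the extended reals, so that inf of the empty set (which
   only occurs for finite-dimensional Y) is +oo. *)
Definition auc_modulus (N : Y -> R) (t : R) : \bar R :=
  (ereal_inf [set ereal_sup [set ereal_inf
      [set (N (y + t *: z))%R%:E | z in sphere N Z]
    | Z in cof] | y in sphere N setT] - 1)%E.

Definition amuc_modulus (N : Y -> R) (t : R) : \bar R :=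
  (ereal_inf [set ereal_sup [set ereal_inf
      [set (Num.max (N (y + t *: z)) (N (y - t *: z)))%R%:E | z in sphere N Z]
    | Z in cof] | y in sphere N setT] - 1)%E.

Definition asymptotically_uniformly_convex (N : Y -> R) : Prop :=
  forall t : R, 0 < t < 1 -> (0 < auc_modulus N t)%E.

Definition asymptotically_midpoint_uniformly_convex (N : Y -> R) : Prop :=
  forall t : R, 0 < t < 1 -> (0 < amuc_modulus N t)%E.

End AsymptoticStructure.

Arguments separable T : clear implicits.
Arguments reflexive_space {R} Y.
Arguments unconditional_asymptotic_structure {R} Y.

(* Main.v *)
Require Import Defs.
From HB Require Import structures.
From mathcomp Require Import all_boot all_order all_algebra.
From mathcomp Require Import all_classical all_reals all_analysis.
From mathcomp Require Import lra.

Set Implicit Arguments.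
Unset Strict Implicit.
Unset Printing Implicit Defensive.

Import Order.TTheory GRing.Theory Num.Theory.
Import numFieldNormedType.Exports.

Local Open Scope classical_set_scope.
Local Open Scope ring_scope.

(* Two games drive the proof.  On [Y], player I picks a finite-codimensional
   subspace and player II a vector of it.  If some norm is asymptotically
   midpoint uniformly convex, player II's vectors always admit signs for which
   the signed sums grow with the total length of the vectors; unconditionality
   then makes the plain sums grow as well.

   On the dual, player I picks finitely many points of [Y] and player II a
   functional of norm at most 1 that is small on them.  If for some [e] player I
   could not keep sums of [n] such functionals below [e n], then norming the
   final sums and taking weak limits backwards along an ultrafilter (this is
   where reflexivity enters) would give a tree in the unit ball of [Y], with
   branches of total length about [e n], against which player I's strategy on
   [Y] fails for large [n].

   So sums of [n] functionals can be kept below [e n] for every [e] and some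
   [n].  The average over [k < n] of the values of the [k]-step dual games is
   convex and grows by at most [t e] under one more move of size [t]; the norm on
   [Y] defined by its sublevel set therefore increases by a fixed amount at
   vectors of norm at least [r], when [e] is small with respect to [r].  The
   asymptotically uniformly convex norm is a weighted sum of such norms over a
   sequence of [r]'s tending to 0.  (When [Y] is finite-dimensional, both
   properties hold vacuously.) *)

(** * Hahn-Banach theorem *)

Section HahnBanach.
Variables (R : realType) (V : lmodType R).

(** Only an inequality at positive scalars is asked, since that is what infima deliver; [sublinear0]
    and [sublinearZ] recover the equality and the value at 0. *)
Definition sublinear (p : V -> R) : Prop :=
  (forall x y, p (x + y) <= p x + p y) /\
  (forall a x, 0 < a -> p (a *: x) <= a * p x).

Definition linear_form (f : V -> R) : Prop :=
  forall a x y, f (a *: x + y) = a * f x + f y.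

Lemma sublinear0 p : sublinear p -> p 0 = 0.
Proof.
move=> [_ ph]; have := ph 2 0 (ltr0Sn _ _); have := ph 2^-1 0.
by rewrite !scaler0 invr_gt0 ltr0Sn => /(_ isT) h1 h2; lra.
Qed.

Lemma sublinearZ p a x : sublinear p -> 0 <= a -> p (a *: x) = a * p x.
Proof.
move=> sp; rewrite le_eqVlt => /predU1P[<-|a0].
  by rewrite scale0r mul0r sublinear0.
apply/eqP; rewrite eq_le (sp.2 a x a0) /= -ler_pdivlMl //.
have := sp.2 a^-1 (a *: x); rewrite invr_gt0 a0 scalerA mulVf ?gt_eqF // scale1r.
exact.
Qed.

Lemma sublinear_ge p x : sublinear p -> - p (- x) <= p x.
Proof.
by move=> sp; have := sp.1 x (- x); rewrite subrr sublinear0 // => h; lra.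
Qed.

Lemma linear_formD f x y : linear_form f -> f (x + y) = f x + f y.
Proof. by move=> lf; have := lf 1 x y; rewrite scale1r mul1r. Qed.

Lemma linear_form0 f : linear_form f -> f 0 = 0.
Proof.
by move=> lf; have := linear_formD 0 0 lf; rewrite addr0 => h; lra.
Qed.

Lemma linear_formZ f a x : linear_form f -> f (a *: x) = a * f x.
Proof. by move=> lf; have := lf a x 0; rewrite addr0 linear_form0 // addr0. Qed.

Lemma linear_formN f x : linear_form f -> f (- x) = - f x.
Proof. by move=> lf; rewrite -scaleN1r linear_formZ // mulN1r. Qed.

Lemma linear_formB f x y : linear_form f -> f (x - y) = f x - f y.
Proof. by move=> lf; rewrite linear_formD // linear_formN. Qed.

Lemma linear_form_sum f I (s : seq I) (F : I -> V) : linear_form f ->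
  f (\sum_(i <- s) F i) = \sum_(i <- s) f (F i).
Proof.
move=> lf; elim: s => [|i s IH]; first by rewrite !big_nil linear_form0.
by rewrite !big_cons linear_formD // IH.
Qed.

(** Near-optimal indices for [x] and [y] combine into one for [x + y]. Apart from the norm, the
    sublinear functionals built below are all such infima. *)
Lemma sublinear_inf I (A : set I) (phi : I -> V -> R) :
  A !=set0 -> (forall y, has_lbound [set phi i y | i in A]) ->
  (forall i j x y, A i -> A j ->
    exists2 k, A k & phi k (x + y) <= phi i x + phi j y) ->
  (forall a i x, 0 < a -> A i -> exists2 k, A k & phi k (a *: x) <= a * phi i x) ->
  sublinear (fun y => inf [set phi i y | i in A]).
Proof.
move=> [i0 Ai0] hA phiD phiZ.
have nA y : [set phi i y | i in A] !=set0 by exists (phi i0 y); exists i0.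
have infA i y : A i -> inf [set phi i y | i in A] <= phi i y.
  by move=> Ai; apply: ge_inf => //; exists i.
split=> [x y|a x a0].
  rewrite -lerBlDr; apply: lb_le_inf => // _ [i Ai <-].
  rewrite lerBlDl -lerBlDr; apply: lb_le_inf => // _ [j Aj <-].
  have [k Ak kD] := phiD i j x y Ai Aj.
  by rewrite lerBlDl; exact: le_trans (infA k _ Ak) kD.
rewrite -ler_pdivrMl //; apply: lb_le_inf => // _ [i Ai <-].
have [k Ak kZ] := phiZ a i x a0 Ai.
by rewrite ler_pdivrMl //; exact: le_trans (infA k _ Ak) kZ.
Qed.

(** Take the infimum over [t >= 0] of [p (y + t *: z) - t * p z]: [t = 0] gives [q <= p], and
    [t = 1] gives the bound at [- z]. *)
Lemma sublinear_minorant p z : sublinear p ->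
  exists q, [/\ sublinear q, forall y, q y <= p y & q (- z) <= - p z].
Proof.
move=> sp; pose phi t y := p (y + t *: z) - t * p z.
have hA y : has_lbound [set phi t y | t in [set t : R | 0 <= t]].
  exists (- p (- y)) => _ [t /= t0 <-]; rewrite /phi -sublinearZ //.
  have := sp.1 (y + t *: z) (- y); rewrite addrAC subrr add0r => h; lra.
have infA y t : 0 <= t -> inf [set phi t y | t in [set t : R | 0 <= t]] <= phi t y.
  by move=> t0; apply: ge_inf => //; exists t.
exists (fun y => inf [set phi t y | t in [set t : R | 0 <= t]]); split.
- apply: sublinear_inf => //; first by exists 0 => /=.
    move=> t s x y /= t0 s0; exists (t + s); first exact: addr_ge0.
    have := sp.1 (x + t *: z) (y + s *: z); rewrite addrACA -scalerDl /phi => h.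
    lra.
  move=> a t x a0 /= t0; exists (a * t); first exact: mulr_ge0 (ltW a0) t0.
  have := sp.2 a (x + t *: z) a0; rewrite scalerDr scalerA /phi => h; lra.
- move=> y; apply: le_trans (infA y 0 (lexx _)) _.
  by rewrite /phi scale0r addr0 mul0r subr0.
- apply: le_trans (infA (- z) 1 ler01) _.
  by rewrite /phi scale1r addNr sublinear0 // mul1r add0r.
Qed.

(** Lower bounds of chains for Zorn's lemma. The infimum is subadditive because the smaller of two
    members of a chain serves both arguments. *)
Lemma sublinear_chain_inf p
    (A : set {f : V -> R | sublinear f /\ forall y, f y <= p y}) :
  total_on A (fun f g => `[< forall y, sval g y <= sval f y >]) -> A !=set0 ->
  exists g, [/\ sublinear g, forall y, g y <= p y &
    forall f, A f -> forall y, g y <= sval f y].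
Proof.
move=> totA [f0 Af0].
have hA y : has_lbound [set sval f y | f in A].
  exists (- p (- y)) => _ [f Af <-]; have [sf fp] := svalP f.
  by apply: le_trans (sublinear_ge _ sf); rewrite lerN2.
have infA f y : A f -> inf [set sval f y | f in A] <= sval f y.
  by move=> Af; apply: ge_inf => //; exists f.
exists (fun y => inf [set sval f y | f in A]); split; last 2 first.
- by move=> y; apply: le_trans (infA f0 y Af0) _; exact: (svalP f0).2.
- by move=> f Af y; exact: infA.
apply: sublinear_inf => //; first by exists f0.
- move=> f g x y Af Ag; have [|] := totA _ _ Af Ag => /asboolP fg.
    exists g => //; apply: le_trans ((svalP g).1.1 _ _) _.
    by rewrite lerD2r.
  exists f => //; apply: le_trans ((svalP f).1.1 _ _) _.
  by rewrite lerD2l.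
- by move=> a f x a0 Af; exists f => //; exact: (svalP f).1.2.
Qed.

(* By Zorn's lemma there is a minimal sublinear functional below [p], and it is
   linear since [sublinear_minorant] cannot decrease it. *)
Lemma sublinear_linear_minorant p : sublinear p ->
  exists2 f, linear_form f & forall y, f y <= p y.
Proof.
move=> sp.
pose T := {f : V -> R | sublinear f /\ forall y, f y <= p y}.
pose Q (f g : T) := `[< forall y, sval g y <= sval f y >].
pose t0 : T := exist _ p (conj sp (fun y => lexx _)).
have [| | |f fmin] := @ZL_preorder T t0 Q.
- by move=> t; apply/asboolP.
- move=> r s t /asboolP rs /asboolP st; apply/asboolP => y.
  exact: le_trans (st y) (rs y).
- move=> A totA; have [->|/set0P nA] := eqVneq A set0; first by exists t0.
  have [g [sg gp gA]] := sublinear_chain_inf totA nA.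
  by exists (exist _ g (conj sg gp)) => s As; apply/asboolP => y; exact: gA.
have [sf fp] := svalP f.
have fN z : sval f (- z) = - sval f z.
  have [q [sq qf qz]] := sublinear_minorant z sf.
  have qp y : q y <= p y by apply: le_trans (qf y) (fp y).
  have /fmin/asboolP/= fq : Q f (exist _ q (conj sq qp)).
    by apply/asboolP.
  have h := le_trans (fq _) qz.
  by apply/eqP; rewrite eq_le h /= lerNl -[in leRHS](opprK z) lerNl sublinear_ge.
exists (sval f) => // a x y.
have fD u v : sval f (u + v) = sval f u + sval f v.
  apply/eqP; rewrite eq_le sf.1 /=.
  have := sf.1 (- u) (- v); rewrite -opprD !fN => h; lra.
rewrite fD; congr (_ + _).
have [a0|a0] := leP 0 a; first exact: sublinearZ.
by rewrite -[a in LHS]opprK scaleNr fN sublinearZ ?mulNr ?opprK // oppr_ge0 ltW.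
Qed.

(** A linear form below the [q] of [sublinear_minorant] is at most [- p z] at [- z], hence at least
    [p z] at [z]. *)
Theorem Hahn_Banach p z : sublinear p ->
  exists f, [/\ linear_form f, forall y, f y <= p y & f z = p z].
Proof.
move=> sp; have [q [sq qp qz]] := sublinear_minorant z sp.
have [f lf fq] := sublinear_linear_minorant sq; exists f; split => //.
  by move=> y; exact: le_trans (fq y) (qp y).
apply/eqP; rewrite eq_le (le_trans (fq z) (qp z)) /=.
by have := le_trans (fq (- z)) qz; rewrite linear_formN // lerN2.
Qed.

End HahnBanach.

(** * Bounded functionals and finite-codimensional subspaces *)

Section BoundedForms.
Variables (R : realType) (Y : normedModType R).

Definition dual_ball (f : Y -> R) : Prop :=
  linear_form f /\ forall y, `|f y| <= `|y|.

Definition bounded_form (f : Y -> R) : Prop :=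
  linear_form f /\ exists M, forall y, `|f y| <= M * `|y|.

Lemma dual_ball_bounded f : dual_ball f -> bounded_form f.
Proof. by move=> [lf f1]; split=> //; exists 1 => y; rewrite mul1r. Qed.

Lemma bounded_formP f : bounded_form f ->
  exists2 M, 0 < M & forall y, `|f y| <= M * `|y|.
Proof.
move=> [_ [M fM]]; exists (`|M| + 1) => [|y]; first by rewrite ltr_wpDl.
apply: le_trans (fM y) _; rewrite ler_wpM2r //.
by apply: le_trans (ler_norm M) _; rewrite lerDl.
Qed.

Lemma bounded_formB f g b : bounded_form f -> bounded_form g ->
  bounded_form (fun y => f y - b * g y).
Proof.
move=> [lf [M fM]] [lg [M' gM]]; split=> [a x y|].
  by rewrite lf lg; lra.
exists (M + `|b| * M') => y; apply: le_trans (ler_normB _ _) _.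
by rewrite mulrDl lerD // normrM -mulrA ler_wpM2l.
Qed.

Lemma normed_sublinear : sublinear (fun y : Y => `|y|).
Proof.
split=> [x y|a x a0]; first exact: ler_normD.
by rewrite normrZ gtr0_norm.
Qed.

Lemma form_le_norm (f : Y -> R) : linear_form f -> (forall y, f y <= `|y|) ->
  dual_ball f.
Proof.
move=> lf fle; split=> // y; rewrite ler_norml fle andbT lerNl.
by rewrite -linear_formN // (le_trans (fle _)) ?normrN.
Qed.

Lemma norming_form (y : Y) : exists2 f, dual_ball f & f y = `|y|.
Proof.
have [f [lf fle fy]] := Hahn_Banach y normed_sublinear.
by exists f => //; exact: form_le_norm.
Qed.

Lemma closed_normP (Z : set Y) :
  closed Z <-> forall y, (forall e, 0 < e -> exists2 z, Z z & `|y - z| < e) -> Z y.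
Proof.
split=> [cZ y yZ|h y yZ].
  apply: cZ => B /nbhs_normP[e /= e0 eB]; have [z Zz yz] := yZ e e0.
  by exists z; split => //; exact: eB.
apply: h => e e0; have [z [Zz yz]] := yZ _ (nbhsx_ballx y e e0).
by exists z => //; move: yz; rewrite -ball_normE.
Qed.

Section Subspace.
Variable Z : set Y.
Hypothesis subZ : submod_closed [in Z].

Lemma submod0 : Z 0.
Proof. by have [] := subZ; rewrite inE. Qed.

Lemma submodZD a x y : Z x -> Z y -> Z (a *: x + y).
Proof.
by move=> Zx Zy; have [_ /(_ a x y)] := subZ; rewrite !inE; apply.
Qed.

Lemma submodD x y : Z x -> Z y -> Z (x + y).
Proof. by move=> Zx Zy; rewrite -[x]scale1r; exact: submodZD. Qed.

Lemma submodZ a x : Z x -> Z (a *: x).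
Proof. by move=> Zx; rewrite -[_ *: _]addr0; apply: submodZD => //; exact: submod0. Qed.

(** Hahn-Banach for the distance to [Z]: it is positive at [v] since [Z] is closed, and a linear
    form below it vanishes on [Z]. *)
Lemma separation v : closed Z -> ~ Z v ->
  exists f, [/\ bounded_form f, forall z, Z z -> f z = 0 & f v = 1].
Proof.
move=> /closed_normP cZ Zv; pose q y := inf [set `|y - z| | z in Z].
have lbq y : has_lbound [set `|y - z| | z in Z].
  by exists 0 => _ [z _ <-].
have qle z y : Z z -> q y <= `|y - z| by move=> Zz; apply: ge_inf => //; exists z.
have sq : sublinear q.
  apply: sublinear_inf => //; first by exists 0; exact: submod0.
    move=> z z' x y Zz Zz'; exists (z + z'); first exact: submodD.
    by rewrite opprD addrACA; exact: ler_normD.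
  move=> a z x a0 Zz; exists (a *: z); first exact: submodZ.
  by rewrite -scalerBr normrZ gtr0_norm.
have qv : 0 < q v.
  rewrite ltNge; apply/negP => qv; apply: Zv; apply: cZ => e e0.
  have hv : has_inf [set `|v - z| | z in Z].
    by split => //; exists `|v - 0|; exists 0 => //; exact: submod0.
  have [_ [z Zz <-] vz] := inf_adherent e0 hv; exists z => //.
  by apply: lt_le_trans vz _; rewrite gerDr.
have [f [lf fq fv]] := Hahn_Banach v sq.
have f1 : dual_ball f.
  apply: form_le_norm => // y; apply: le_trans (fq y) _.
  by rewrite -[y in leRHS]subr0; apply: qle; exact: submod0.
have fZ z : Z z -> f z <= 0.
  by move=> Zz; apply: le_trans (fq z) _; rewrite -[0](@normr0 _ Y) -(subrr z) qle.
exists (fun y => (q v)^-1 * f y); split.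
- split=> [a x y|]; first by rewrite lf; lra.
  exists (q v)^-1 => y; have q0 : 0 <= (q v)^-1 by rewrite invr_ge0 ltW.
  by rewrite normrM (ger0_norm q0) ler_wpM2l // f1.2.
- move=> z Zz; suff -> : f z = 0 by rewrite mulr0.
  apply/eqP; rewrite eq_le fZ //= -oppr_le0 -linear_formN // fZ //.
  by rewrite -scaleN1r; exact: submodZ.
- by rewrite fv mulVf // gt_eqF.
Qed.

End Subspace.

(** Finite lists of bounded functionals replace members of [cof] in the games: by [cof_kernel] and
    [cof_supkernel] their kernels are cofinal there, and intersecting kernels is concatenating
    lists. *)
Definition kernel (fs : seq (Y -> R)) : set Y :=
  [set y | forall f, f \in fs -> f y = 0].

Definition bounded_forms (fs : seq (Y -> R)) : Prop :=
  forall f, f \in fs -> bounded_form f.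

Lemma kernel_cat fs gs y : kernel (fs ++ gs) y <-> kernel fs y /\ kernel gs y.
Proof.
split=> [h|[h1 h2] f]; last by rewrite mem_cat => /orP[/h1|/h2].
by split=> f ff; apply: h; rewrite mem_cat ff ?orbT.
Qed.

Lemma kernel_cons f fs y : kernel (f :: fs) y <-> f y = 0 /\ kernel fs y.
Proof.
split=> [h|[h1 h2] g]; last by rewrite inE => /predU1P[->|/h2].
by split=> [|g gfs]; apply: h; rewrite inE ?eqxx ?gfs ?orbT.
Qed.

Lemma bounded_forms_cat fs gs :
  bounded_forms fs -> bounded_forms gs -> bounded_forms (fs ++ gs).
Proof. by move=> h1 h2 f; rewrite mem_cat => /orP[/h1|/h2]. Qed.

Lemma bounded_forms_cons f fs :
  bounded_form f -> bounded_forms fs -> bounded_forms (f :: fs).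
Proof. by move=> h1 h2 g; rewrite inE => /predU1P[->|/h2]. Qed.

Lemma kernel_submod fs : bounded_forms fs -> submod_closed [in kernel fs].
Proof.
move=> bfs; split; rewrite ?inE.
  by move=> f /bfs [lf _]; exact: linear_form0.
move=> a x y; rewrite !inE => kx ky f ffs; have [lf _] := bfs f ffs.
by rewrite lf kx // ky // mulr0 addr0.
Qed.

Lemma kernel_closed fs : bounded_forms fs -> closed (kernel fs).
Proof.
move=> bfs; apply/closed_normP => y hy f ffs.
have bf := bfs f ffs; have [M M0 fM] := bounded_formP bf.
apply/eqP/negPn/negP => fy.
have e0 : 0 < `|f y| / M by rewrite divr_gt0 // normr_gt0.
have [z kz] := hy _ e0; rewrite ltr_pdivlMr // ltNge mulrC => /negP; apply.
by apply: le_trans (fM _); rewrite linear_formB ?(kz f ffs) ?subr0 //; exact: bf.1.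
Qed.

(** A bounded finite-rank correction moves every vector into the kernel. By induction on the list: a
    new [f] either vanishes on the old kernel or is corrected along some [u] of that kernel with
    [f u] nonzero. *)
Lemma kernel_projection fs : bounded_forms fs ->
  exists2 s : seq ((Y -> R) * Y), (forall p, p \in s -> bounded_form p.1) &
    forall y, kernel fs (y - \sum_(p <- s) p.1 y *: p.2).
Proof.
elim: fs => [|f fs IH] bfs; first by exists [::] => // y f.
have bf : bounded_form f by apply: bfs; rewrite inE eqxx.
have bfs' : bounded_forms fs by move=> g gfs; apply: bfs; rewrite inE gfs orbT.
have [s bs sK] := IH bfs'; have lf := bf.1.
have [fK|/existsNP[u /not_implyP[uK fu]]] := pselect (forall y, kernel fs y -> f y = 0).
  by exists s => // y; apply/kernel_cons; split; [exact: fK|].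
pose h y := (f u)^-1 * f (y - \sum_(p <- s) p.1 y *: p.2).
exists ((h, u) :: s).
  move=> p; rewrite inE => /predU1P[->|]; last exact: bs.
  have -> : h = fun y => (f u)^-1 * (f y - \sum_(p <- s) p.1 y * f p.2).
    apply/funext => y; rewrite /h linear_formB // linear_form_sum //.
    congr (_ * (_ - _)); apply: eq_bigr => q _; exact: linear_formZ.
  have : bounded_form (fun y => f y - \sum_(p <- s) p.1 y * f p.2).
    elim: s bs {sK h} => [|q s IHs] bs.
      by under eq_fun do rewrite big_nil subr0.
    rewrite (_ : (fun _ => _) = fun y =>
      (f y - \sum_(p <- s) p.1 y * f p.2) - f q.2 * q.1 y); last first.
      by apply/funext => y; rewrite big_cons; lra.
    apply: bounded_formB; last by apply: bs; rewrite inE eqxx.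
    by apply: IHs => r rs; apply: bs; rewrite inE rs orbT.
  move=> [lg [M gM]]; split=> [a x y|]; first by have /= -> := lg a x y; lra.
  exists (`|(f u)^-1| * M) => y; rewrite normrM -mulrA.
  by rewrite ler_wpM2l.
move=> y; rewrite big_cons opprD addrCA addrC; apply/kernel_cons; split.
  rewrite linear_formB // linear_formZ // /h mulrAC mulVf ?mul1r ?subrr //.
  exact/eqP.
rewrite -scaleNr addrC; apply: (submodZD (kernel_submod bfs')) => //.
Qed.

Lemma cof_kernel fs : bounded_forms fs -> cof (kernel fs).
Proof.
move=> bfs; split; [exact: kernel_submod|exact: kernel_closed|].
have [s bs sK] := kernel_projection bfs.
pose d : (Y -> R) * Y := (fun=> 0, 0).
exists (size s), (fun i => (nth d s i).2) => y.
exists (fun i => (nth d s i).1 y), (y - \sum_(p <- s) p.1 y *: p.2); split=> //.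
rewrite (big_nth d) big_mkord subrK //.
Qed.

(** Induction on the number of vectors spanning the quotient: the first is either in [Z], hence
    redundant, or separated from [Z] by a functional [f], and then [Z] is the kernel of [f] in the
    span [Z'] of [Z] and that vector. *)
Lemma cof_supkernel Z : cof Z ->
  exists2 fs, bounded_forms fs & kernel fs `<=` Z.
Proof.
move=> [sZ cZ [n]]; elim: n Z sZ cZ => [|n IH] Z sZ cZ [v vZ].
  exists [::] => // y _; have [a [z [Zz ->]]] := vZ y.
  by rewrite big_ord0 addr0.
have [Zv|Zv] := pselect (Z (v ord0)).
  apply: IH => //; exists (fun i => v (lift ord0 i)) => y.
  have [a [z [Zz ->]]] := vZ y; rewrite big_ord_recl addrA.
  exists (fun i => a (lift ord0 i)), (z + a ord0 *: v ord0); split=> //.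
  by apply: submodD => //; exact: submodZ.
have [f [bf fZ fv]] := separation sZ cZ Zv; have lf := bf.1.
pose Z' := [set y | Z (y - f y *: v ord0)].
have [||| fs bfs fsZ'] := IH Z'.
- split; rewrite ?inE /Z' /=.
    by rewrite linear_form0 // scale0r subr0; exact: submod0.
  move=> a x y; rewrite !inE /= => Zx Zy.
  have -> : a *: x + y - f (a *: x + y) *: v ord0 =
      a *: (x - f x *: v ord0) + (y - f y *: v ord0).
    by rewrite lf scalerBr scalerDl scalerA opprD addrACA.
  exact: submodZD.
(* [Z'] is the preimage of [Z] under [y - f y *: v ord0], which multiplies norms by at most
   [1 + M * |v ord0|]; so it is closed. *)
- have [M M0 fM] := bounded_formP bf.
  apply/closed_normP => y hy; move/closed_normP: cZ; apply=> e e0.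
  have K0 : 0 < 1 + M * `|v ord0| by rewrite ltr_wpDr // mulr_ge0 // ltW.
  have [z Zz yz] := hy _ (divr_gt0 e0 K0); exists (z - f z *: v ord0) => //.
  move: yz; rewrite ltr_pdivlMr //; apply: le_lt_trans.
  have -> : y - f y *: v ord0 - (z - f z *: v ord0) =
      (y - z) - f (y - z) *: v ord0.
    by rewrite linear_formB // scalerBl !opprD !opprK addrACA.
  apply: le_trans (ler_normB _ _) _; rewrite normrZ mulrDr mulr1 lerD2l.
  by rewrite mulrA ler_wpM2r // mulrC.
- exists (fun i => v (lift ord0 i)) => y.
  have [a [z [Zz ->]]] := vZ y; rewrite big_ord_recl addrA.
  exists (fun i => a (lift ord0 i)), (z + a ord0 *: v ord0); split=> //.
  rewrite /Z' /= linear_formD // linear_formZ // fv mulr1 fZ // add0r.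
  by rewrite addrK.
exists (f :: fs); first exact: bounded_forms_cons.
move=> y /kernel_cons[fy /fsZ']; rewrite /Z' /= fy scale0r subr0 //.
Qed.

Lemma topological_dualP (f : Y -> R) : topological_dual f <-> bounded_form f.
Proof.
split=> [[lf cf]|[lf [M fM]]].
  pose g : {linear Y -> R^o} := HB.pack f (GRing.isLinear.Build _ _ _ _ f lf).
  split=> //.
  have /linear_bounded_continuous/linear_boundedP : continuous g by [].
  by move=> /pinfty_ex_gt0[r r0 fr]; exists r.
have lf' : linear (f : Y -> R^o) by exact: lf.
split; first exact: lf'.
pose g : {linear Y -> R^o} := HB.pack (f : Y -> R^o) (GRing.isLinear.Build _ _ _ _ _ lf').
suff : continuous g by [].
apply/linear_bounded_continuous/linear_boundedP.
near=> r => x; apply: le_trans (fM x) _; exact: ler_wpM2r.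
Unshelve. all: by end_near. Qed.

End BoundedForms.

(** * Polars of finite sets *)

Section Polars.
Variables (R : realType) (Y : normedModType R).

(** Smallness on [F] is normalised to the bound 1; smaller bounds are obtained by putting large
    multiples of points into [F]. *)
Definition polar (F : seq Y) (w : Y -> R) : Prop :=
  dual_ball w /\ forall v, v \in F -> `|w v| <= 1.

Lemma interval_net (A t : R) : 0 < t ->
  exists G : seq R, forall x, `|x| <= A -> exists2 g, g \in G & `|x - g| <= t.
Proof.
move=> t0; exists [seq - A + k%:R * t | k <- iota 0 (Num.truncn (A *+ 2 / t)).+1].
move=> x; rewrite ler_norml => /andP[xA Ax].
have xA0 : 0 <= x + A by lra.
have q0 : 0 <= (x + A) / t by rewrite divr_ge0 // ltW.
exists (- A + (Num.truncn ((x + A) / t))%:R * t).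
  apply/mapP; eexists; last reflexivity.
  rewrite mem_iota add0n ltnS /= le_truncn // ler_pM2r ?invr_gt0 //; lra.
have /andP[] := truncn_itv q0; rewrite ler_pdivlMr // ltr_pdivrMr // -natr1.
by set k := _%:R => h1 h2; rewrite ler_norml; apply/andP; split; lra.
Qed.

Lemma combination_net (F : seq Y) (A t : R) : 0 < t ->
  exists S : seq Y, forall a : nat -> R, (forall i, (i < size F)%N -> `|a i| <= A) ->
    exists2 u, u \in S & `|\sum_(i < size F) a i *: F`_i - u| <= t.
Proof.
elim: F t => [|v F IH] t t0.
  exists [:: 0] => a _; exists 0; first by rewrite inE.
  by rewrite big_ord0 subrr normr0 ltW.
have t2 : 0 < t / 2 by lra.
have [S SP] := IH _ t2.
have v1 : 0 < `|v| + 1 by rewrite ltr_wpDl.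
have [G GP] := interval_net A (divr_gt0 t2 v1).
exists [seq g *: v + u | g <- G, u <- S] => a aA.
have [u uS hu] := SP (fun i => a i.+1) (fun i => aA i.+1).
have [g gG hg] := GP (a 0%N) (aA 0%N isT).
exists (g *: v + u); first by apply/allpairsP; exists (g, u).
rewrite big_ord_recl /= opprD addrACA -scalerBl.
apply: le_trans (ler_normD _ _) _; rewrite [t]splitr lerD //.
rewrite normrZ; move: hg; rewrite ler_pdivlMr //; apply: le_trans.
by rewrite ler_wpM2l // lerDl.
Qed.

(** Let [z] be a unit vector. A coefficient above 1 makes the second sum large. Otherwise the
    combination [c'] is within 1/4 of a net point [u], and [z] is killed by the norming functional
    of [u], so [|z + c'|] is at least [|c'| - 1/2]; it is also at least [1 - |c'|]. *)
Lemma kernel_avoids_combinations (F : seq Y) :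
  exists2 fs, bounded_forms fs & forall z, kernel fs z -> forall a : nat -> R,
    `|z| / 4 <= `|z + \sum_(i < size F) a i *: F`_i| + \sum_(i < size F) `|a i|.
Proof.
have t4 : 0 < 4^-1 :> R by lra.
have [S SP] := combination_net F 1 t4.
have nfE (y : Y) : exists f : Y -> R, dual_ball f /\ f y = `|y|.
  by have [f f1 fy] := norming_form y; exists f.
have [nf nfP] := boolp.choice nfE.
exists [seq nf u | u <- S].
  by move=> _ /mapP[u uS ->]; exact: dual_ball_bounded (nfP u).1.
move=> z kz a; have [->|z0] := eqVneq z 0.
  by rewrite normr0 mul0r addr_ge0 // sumr_ge0.
have nz : 0 < `|z| by rewrite normr_gt0.
have [a1|/existsNP[i /not_implyP[iF /negP ai]]] :=
    pselect (forall i, (i < size F)%N -> `|a i / `|z| | <= 1); last first.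
  apply: le_trans (_ : `|z| <= _); first by rewrite ler_pdivrMr //; lra.
  rewrite [X in _ + X](bigD1 (Ordinal iF)) //= [leRHS]addrCA; apply: ler_wpDr.
    by rewrite addr_ge0 // sumr_ge0.
  move: ai; rewrite -ltNge normrM normfV normr_id ltr_pdivlMr // mul1r.
  exact: ltW.
set c := \sum_(i < _) _; apply: ler_wpDr; first by rewrite sumr_ge0.
have [u uS] := SP (fun i => a i / `|z|) a1; set c' := \sum_(i < _) _ => hu.
have cE : c = `|z| *: c'.
  rewrite /c /c' scaler_sumr; apply: eq_bigr => i _.
  by rewrite scalerA mulrCA divff ?mulr1 // gt_eqF.
have zE : z = `|z| *: (`|z|^-1 *: z) by rewrite scalerA divff ?scale1r // gt_eqF.
have z1 : `| `|z|^-1 *: z| = 1.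
  by rewrite normrZ normfV normr_id mulVf // gt_eqF.
have h1 : `|u| <= `| `|z|^-1 *: z + u|.
  have [[lf fle] fu] := nfP u; have kfz : nf u z = 0 by apply/kz/map_f.
  rewrite -{1}fu; apply: le_trans (fle _); apply: le_trans (ler_norm _).
  by rewrite linear_formD // linear_formZ // kfz mulr0 add0r.
rewrite [in leRHS]zE cE -scalerDr normrZ normr_id ler_wpM2l //.
have h2 := lerB_normD (`|z|^-1 *: z) c'.
have h3 := ler_normD (`|z|^-1 *: z + c') (u - c').
rewrite addrACA subrr addr0 in h3.
have h4 : `|c'| <= `|u| + `|c' - u| by rewrite -{1}(subrK u c') addrC ler_normD.
rewrite distrC in hu.
have h5 := ler_normD (u - c') c'; rewrite distrC in h4; rewrite z1 in h2; lra.
Qed.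

(** Linear forms below the infimum [p] of the expressions bounded in [kernel_avoids_combinations]
    lie in [polar F]; Hahn-Banach gives one attaining [p z]. *)
Lemma polar_large (F : seq Y) :
  exists2 fs, bounded_forms fs & forall z, kernel fs z ->
    exists2 w, polar F w & `|z| / 4 <= w z.
Proof.
have [fs bfs fsP] := kernel_avoids_combinations F; exists fs => // z kz.
pose phi (a : nat -> R) y :=
  `|y + \sum_(i < size F) a i *: F`_i| + \sum_(i < size F) `|a i|.
have phi_ge0 a y : 0 <= phi a y by rewrite addr_ge0 // sumr_ge0.
have hphi y : has_lbound [set phi a y | a in setT].
  by exists 0 => _ [a _ <-].
pose p y := inf [set phi a y | a in setT].
have ple a y : p y <= phi a y by apply: ge_inf => //; exists a.
have sp : sublinear p.
  apply: sublinear_inf => //; first by exists (fun=> 0).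
    move=> a b x y _ _; exists (fun i => a i + b i) => //; rewrite /phi.
    rewrite addrACA; apply: lerD; last first.
      by rewrite -big_split; apply: ler_sum => i _; exact: ler_normD.
    under eq_bigr do rewrite scalerDl.
    by rewrite big_split addrACA; exact: ler_normD.
  move=> b a x b0 _; exists (fun i => b * a i) => //; rewrite /phi.
  under eq_bigr do rewrite -scalerA.
  rewrite -scaler_sumr -scalerDr normrZ gtr0_norm //.
  by under [X in _ + X]eq_bigr do rewrite normrM gtr0_norm //; rewrite -mulr_sumr -mulrDr.
have [f [lf fp fz]] := Hahn_Banach z sp.
have fF s v : `|s| = 1 -> v \in F -> f (s *: v) <= 1.
  move=> s1 /(nthP 0)[i iF <-]; apply: le_trans (fp _) _.
  (* These coefficients cancel the vector [s *: v] entirely, at cost [|s| = 1]. *)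
  apply: le_trans (ple (fun j => if j == i then - s else 0) _) _; rewrite /phi.
  rewrite (bigD1 (Ordinal iF)) //= big1 ?eqxx; last first.
    by move=> j /negPf; rewrite -val_eqE /= => ->; rewrite scale0r.
  rewrite addr0 scaleNr subrr normr0 add0r.
  rewrite (bigD1 (Ordinal iF)) //= big1 ?eqxx ?normrN ?s1 ?addr0 //.
  by move=> j /negPf; rewrite -val_eqE /= => ->; rewrite normr0.
exists f; last first.
  rewrite fz; apply: lb_le_inf; first by exists (phi (fun=> 0) z); exists (fun=> 0).
  by move=> _ [a _ <-]; exact: fsP.
split; last first.
  move=> v vF; rewrite ler_norml lerNl -mulN1r -!linear_formZ // fF ?normrN1 //.
  by rewrite -[v]scale1r fF // normr1.
apply: form_le_norm => // y; apply: le_trans (fp y) _.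
apply: le_trans (ple (fun=> 0) y) _; rewrite /phi big1 => [|i _]; last first.
  by rewrite scale0r.
by rewrite addr0 big1 ?addr0 // => i _; rewrite normr0.
Qed.

Lemma dual_ball0 : @dual_ball R Y (fun=> 0).
Proof. by split=> [a x y|y]; rewrite ?normr0 // mulr0 addr0. Qed.

Lemma polar0 F : polar F (fun=> 0).
Proof. by split=> [|v _]; [exact: dual_ball0|rewrite normr0]. Qed.

Lemma polar_cat F F' w : polar (F ++ F') w -> polar F w /\ polar F' w.
Proof. by move=> [bw h]; split; split=> // v vF; apply: h; rewrite mem_cat vF ?orbT. Qed.

End Polars.

(** * The game on the space *)

Section Games.
Variables (R : realType) (Y : normedModType R).

(* Player I moves by choosing the finite list [fs], player II by choosing a point
   of its kernel; [P] is the winning condition of player I after [k] rounds. *)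
Fixpoint forceable (k : nat) (P : seq Y -> Prop) : Prop :=
  match k with
  | 0 => P [::]
  | k.+1 => exists2 fs, bounded_forms fs &
      forall z, kernel fs z -> forceable k (fun s => P (z :: s))
  end.

Lemma forceable_mono k P Q :
  (forall zs, size zs = k -> P zs -> Q zs) -> forceable k P -> forceable k Q.
Proof.
elim: k P Q => [|k IH] P Q PQ /=; first exact: PQ.
move=> [fs bfs h]; exists fs => // z kz; apply: IH (h z kz) => zs szs.
by apply: PQ; rewrite /= szs.
Qed.

Lemma forceable_and k P Q : forceable k P -> forceable k Q ->
  forceable k (fun zs => P zs /\ Q zs).
Proof.
elim: k P Q => [//|k IH] P Q /= [fs bfs hP] [gs bgs hQ].
exists (fs ++ gs); first exact: bounded_forms_cat.
by move=> z /kernel_cat[/hP ? /hQ ?]; exact: IH.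
Qed.

Lemma forceable_triv k (P : seq Y -> Prop) :
  (forall zs, size zs = k -> P zs) -> forceable k P.
Proof.
elim: k P => [|k IH] P h /=; first exact: h.
by exists [::] => // z _; apply: IH => zs szs; apply: h; rewrite /= szs.
Qed.

(** A relation rather than a sum over a sign function, since signs are chosen one at a time during
    the game. *)
Fixpoint signed_sum (zs : seq Y) (v : Y) : Prop :=
  match zs with
  | [::] => v = 0
  | z :: zs => exists (b : bool) u, signed_sum zs u /\ v = (-1) ^+ b *: z + u
  end.

Lemma signed_sum_scaled (a : seq R) (s : seq Y) v : size a = size s ->
  signed_sum [seq p.1 *: p.2 | p <- zip a s] v ->
  exists e : nat -> bool, v = \sum_(i < size s) ((-1) ^+ e i * a`_i) *: s`_i.
Proof.
elim: a s v => [|r a IH] [|x s] //= v.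
  by move=> _ ->; exists (fun=> false); rewrite big_ord0.
move=> [ss] [b [u [su ->]]]; have [e ->] := IH _ _ ss su.
exists (fun i => if i is j.+1 then e j else b).
by rewrite big_ord_recl /= scalerA.
Qed.

Lemma sum_scaled (a : seq R) (s : seq Y) : size a = size s ->
  \sum_(z <- [seq p.1 *: p.2 | p <- zip a s]) z = \sum_(i < size s) a`_i *: s`_i.
Proof.
elim: a s => [|r a IH] [|x s] //=; first by rewrite big_nil big_ord0.
by move=> [ss]; rewrite big_cons big_ord_recl IH.
Qed.

Hypothesis infinite_dim : forall Z : set Y, cof Z -> sphere Num.norm Z !=set0.

(** The strategy expects unit vectors, so each vector played is normalised and its length is
    recorded in [a]. *)
Lemma asymptotically_forceable n (P : n.-tuple Y -> Prop) : asymptotically P ->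
  forceable n (fun zs => exists (s : n.-tuple Y) (a : n.-tuple R),
    P s /\ zs = [seq p.1 *: p.2 | p <- zip a s]).
Proof.
elim: n P => [|n IH] P /=; first by move=> P0; exists [tuple], [tuple].
move=> [Z [cZ ZP]]; have [fs bfs fsZ] := cof_supkernel cZ.
exists fs => // z /fsZ Zz.
have [x [r [Zx ->]]] : exists x r, sphere Num.norm Z x /\ z = r *: x.
  (* The zero vector has no direction: any unit vector of [Z] is used, with coefficient 0. *)
  have [->|z0] := eqVneq z 0.
    by have [x Zx] := infinite_dim cZ; exists x, 0; rewrite scale0r.
  exists (`|z|^-1 *: z), `|z|; rewrite scalerA divff ?scale1r ?normr_eq0 //.
  split=> //; split; last by rewrite normrZ normfV normr_id mulVf // normr_eq0.
  by apply: submodZ => //; case: cZ.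
apply: forceable_mono (IH _ (ZP x Zx)) => zs _ [s [a [Ps ->]]].
by exists [tuple of x :: s], [tuple of r :: a].
Qed.

Lemma unconditional_forceable C n : asymptotically (@unconditional R Y C n) ->
  forceable n (fun zs => forall v, signed_sum zs v -> `|v| <= C * `|\sum_(z <- zs) z|).
Proof.
move=> /asymptotically_forceable; apply: forceable_mono => _ _ [s [a [us ->]]] v.
have sa : size a = size s by rewrite !size_tuple.
move=> /(signed_sum_scaled sa)[e ->]; rewrite (sum_scaled sa) size_tuple.
have := us (fun j => a`_j) (fun j => e j).
by under eq_bigr do rewrite (tnth_nth 0); under [in leRHS]eq_bigr do rewrite (tnth_nth 0).
Qed.

Section Norm.
Variable N : Y -> R.
Hypothesis ND : forall x y, N (x + y) <= N x + N y.
Hypothesis NZ : forall (a : R) x, N (a *: x) = `|a| * N x.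

Lemma seminorm_max_ge s z : N s <= Num.max (N (s + z)) (N (s - z)).
Proof.
have := ND (s + z) (s - z); rewrite addrACA subrr addr0 -[s in s + s]scale1r.
rewrite -scalerDl NZ ger0_norm // => h.
by rewrite le_max; case: (leP (N s) (N (s + z))) => //= h'; lra.
Qed.

Lemma max_sign s z : exists b : bool,
  Num.max (N (s + z)) (N (s - z)) = N (s + (-1) ^+ b *: z).
Proof.
case: (leP (N (s + z)) (N (s - z))) => _.
  by exists true; rewrite expr1 scaleN1r.
by exists false; rewrite expr0 scale1r.
Qed.

Lemma signed_sum_ge zs s : exists2 v, signed_sum zs v & N s <= N (s + v).
Proof.
elim: zs s => [|z zs IH] s; first by exists 0; rewrite /= ?addr0.
have [b bE] := max_sign s z; have [u su hu] := IH (s + (-1) ^+ b *: z).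
exists ((-1) ^+ b *: z + u); first by exists b, u.
by rewrite addrA; apply: le_trans hu; rewrite -bE; exact: seminorm_max_ge.
Qed.

(** Each vector gets the sign giving the larger norm. The gain [step] is available only while the
    norm is at most [M]; beyond that, [signed_sum_ge] prevents any decrease, whatever is played. *)
Lemma growth_forceable (a e M : R) k s :
  (forall s, N s <= M -> exists2 fs, bounded_forms fs & forall z, kernel fs z ->
    `|z| <= 3 -> N s + a * (`|z| - e) <= Num.max (N (s + z)) (N (s - z))) ->
  forceable k (fun zs => (forall z, z \in zs -> `|z| <= 3) ->
    exists2 v, signed_sum zs v &
      M <= N (s + v) \/ N s + a * \sum_(z <- zs) (`|z| - e) <= N (s + v)).
Proof.
move=> step; elim: k s => [|k IH] s /=.
  by move=> _; exists 0 => //; right; rewrite big_nil mulr0 !addr0.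
have [sM|Ms] := leP (N s) M; last first.
  exists [::] => // z _; apply: forceable_triv => zs _ _.
  have [v sv sle] := signed_sum_ge (z :: zs) s.
  by exists v => //; left; apply: le_trans sle; exact: ltW.
have [fs bfs fsP] := step s sM; exists fs => // z kz.
have [b bE] := max_sign s z.
apply: forceable_mono (IH (s + (-1) ^+ b *: z)) => zs _ h z3.
have [u su hu] := h (fun y yzs => z3 y (mem_behead (s := z :: zs) yzs)).
exists ((-1) ^+ b *: z + u); first by exists b, u.
rewrite addrA; case: hu => hu; [by left|right].
apply: le_trans hu; rewrite -bE big_cons.
have := fsP z kz (z3 z (mem_head _ _)); rewrite mulrDr; lra.
Qed.

End Norm.

End Games.

(** * The game on the dual *)

Section DualGame.
Variables (R : realType) (Y : normedModType R).

(* Starting from [x], player I can keep the norm of [x + t (w_1 + ... + w_k)] at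
   most [c]; a move is a finite [F : seq Y], the answer some [w] in [polar F]. *)
Fixpoint dual_bounded (t : R) (k : nat) (x : Y -> R) (c : R) : Prop :=
  match k with
  | 0 => forall y, `|x y| <= c * `|y|
  | k.+1 => exists F, forall w, polar F w ->
      dual_bounded t k (fun y => x y + t * w y) c
  end.

Lemma dual_norm_ub (f : Y -> R) y : bounded_form f -> `|y| <= 1 ->
  `|f y| <= @dual_norm R Y f.
Proof.
move=> bf y1; have [M M0 fM] := bounded_formP bf.
apply: ub_le_sup; last by exists y.
by exists M => _ [x /= x1 <-]; apply: le_trans (fM x) _; rewrite ger_pMr.
Qed.

Lemma dual_norm_ge (f : Y -> R) M y : bounded_form f -> `|y| <= M ->
  `|f y| <= M * @dual_norm R Y f.
Proof.
move=> bf yM.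
have d0 : 0 <= @dual_norm R Y f.
  by apply: le_trans (dual_norm_ub bf (_ : `|0| <= 1)); rewrite ?normr0.
apply: le_trans (_ : `|y| * @dual_norm R Y f <= _); last by rewrite ler_wpM2r.
have [->|y0] := eqVneq y 0.
  by rewrite (linear_form0 bf.1) !normr0 mul0r.
rewrite -ler_pdivrMl ?normr_gt0 //.
have -> : `|y|^-1 * `|f y| = `|f (`|y|^-1 *: y)|.
  by rewrite (linear_formZ _ _ bf.1) normrM normfV normr_id.
apply: dual_norm_ub => //.
by rewrite normrZ normfV normr_id mulVf // normr_eq0.
Qed.

(** Bounded real families converge along an ultrafilter, so the values of the functionals have
    limits. These define an element of the bidual, which reflexivity represents by a point. *)
Lemma weak_ultralimit T (U : set_system T) (y_ : T -> Y) (M : R) :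
  reflexive_space Y -> UltraFilter U -> (forall i, `|y_ i| <= M) ->
  exists y, forall f, bounded_form f -> f (y_ i) @[i --> U] --> f y.
Proof.
move=> refl UU yM; have PU : ProperFilter U by exact: ultra_proper.
have fcvg f : bounded_form f -> cvg (f (y_ i) @[i --> U]).
  move=> bf; have [K K0 fK] := bounded_formP bf.
  have := @segment_compact R (- (K * M)) (K * M).
  move=> /(_ (f (y_ i) @[i --> U]) _) [].
    apply: (@filterE _ U) => i /=; rewrite in_itv /= -ler_norml.
    by apply: le_trans (fK _) _; rewrite ler_pM2l.
  move=> l [_ lU]; apply/cvg_ex; exists l => B Bl.
  have [//|UB] := in_ultra_setVsetC [set i | B (f (y_ i))] UU.
  have [r [nBr Br]] := lU [set r | ~ B r] B UB Bl.
  by case: (nBr Br).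
have [|y yP] := refl (fun f : Y -> R^o => lim (f (y_ i) @[i --> U])).
  split.
    move=> a f g /topological_dualP bf /topological_dualP bg.
    apply/cvg_lim => //.
    by apply: cvgD; [apply: cvgZr|]; exact: fcvg.
  exists M => f /topological_dualP bf.
  have nM : `|f (y_ i)| @[i --> U] --> `|lim (f (y_ i) @[i --> U])|.
    by apply: cvg_norm; exact: fcvg.
  apply: (closed_cvg (fun r => r <= M * dual_norm f)) nM; first exact: closed_le.
  by apply: (@filterE _ U) => i /=; exact: dual_norm_ge.
exists y => f bf; rewrite -(yP f); last exact/topological_dualP.
exact: fcvg.
Qed.

(** Player I's moves in the dual game serve as index set: along [U] they eventually contain any
    given point. *)
Lemma finset_ultrafilter : exists2 U : set_system (seq Y), UltraFilter U &
  forall v, U [set F | v \in F].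
Proof.
pose B (F0 : seq Y) := [set F : seq Y | {subset F0 <= F}].
have FB : Filter (filter_from [set: seq Y] B).
  apply: filter_from_filter; first by exists [::].
  move=> F1 F2 _ _; exists (F1 ++ F2) => // F h.
  by split=> v vF; apply: h; rewrite mem_cat vF ?orbT.
have PB : ProperFilter (filter_from [set: seq Y] B).
  by apply: filter_from_proper => F _; exists F.
have [U [UU BU]] := ultraFilterLemma PB.
exists U => // v; apply: BU; exists [:: v] => // F; apply; exact: mem_head.
Qed.

(** A finite-rank operator turns weak convergence into norm convergence. *)
Lemma weak_small_sum T (U : set_system T) (y_ : T -> Y) y (s : seq ((Y -> R) * Y)) e :
  Filter U -> (forall p, p \in s -> bounded_form p.1) ->
  (forall f, bounded_form f -> f (y_ i) @[i --> U] --> f y) -> 0 < e ->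
  U [set i | `|\sum_(p <- s) p.1 (y_ i - y) *: p.2| < e].
Proof.
move=> FU bs yy; elim: s e bs => [|p s IH] e bs e0.
  by apply: filterE => i /=; rewrite big_nil normr0.
have e2 : 0 < e / 2 by lra.
have bp : bounded_form p.1 by apply: bs; rewrite inE eqxx.
have p0 : 0 < `|p.2| + 1 by rewrite ltr_wpDl.
have /cvgrPdist_lt /(_ _ (divr_gt0 e2 p0)) h1 := yy _ bp.
have h2 := IH _ (fun q qs => bs q (mem_behead (s := p :: s) qs)) e2.
apply: filterS2 h1 h2 => i /= h1 h2; rewrite big_cons [e]splitr.
apply: le_lt_trans (ler_normD _ _) _; rewrite ltrD // normrZ.
move: h1; rewrite ltr_pdivlMr // distrC -linear_formB; last exact: bp.1.
by apply: le_lt_trans; rewrite ler_wpM2l // lerDl.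
Qed.

(* [y] is the root of a tree of weak limits: the vectors [zs] are, up to errors
   controlled by [d], the successive increments along a branch of that tree. *)
Lemma dual_tree (d : R) k x c : reflexive_space Y -> 0 < d <= 1 ->
  bounded_form x -> ~ dual_bounded 1 k x c ->
  exists2 y, `|y| <= 1 & forall P, forceable k P ->
    exists2 zs, P zs & [/\ size zs = k, `|y + \sum_(z <- zs) z| <= 1 + k%:R * d,
      c - x y - k%:R * d <= \sum_(z <- zs) `|z| & forall z, z \in zs -> `|z| <= 3].
Proof.
move=> refl /andP[d0 d1]; elim: k x c => [|k IH] x c bx /=.
  (* With no move left, the failed bound gives, after normalisation, a unit vector at which [x]
     exceeds [c]. *)
  move=> /existsNP[y /negP]; rewrite -ltNge => hy.
  have y0 : 0 < `|y|.
    rewrite normr_gt0; apply: contraTneq hy => ->.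
    by rewrite (linear_form0 bx.1) !normr0 mulr0 ltxx.
  pose s : R := if 0 <= x y then 1 else -1.
  have sx : s * x y = `|x y|.
    rewrite /s; case: ifPn => [h|]; first by rewrite mul1r ger0_norm.
    by rewrite -ltNge => h; rewrite mulN1r ltr0_norm.
  have s1 : `|s| = 1 by rewrite /s; case: ifP; rewrite ?normrN1 ?normr1.
  exists (`|y|^-1 *: (s *: y)).
    by rewrite !normrZ s1 mul1r normfV normr_id mulVf // gt_eqF.
  move=> P P0; exists [::] => //; split=> //.
  - by rewrite big_nil addr0 mul0r addr0 !normrZ s1 mul1r normfV normr_id mulVf // gt_eqF.
  - rewrite big_nil mul0r subr0 !(linear_formZ _ _ bx.1) sx.
    by rewrite subr_le0 ler_pdivlMl // mulrC ltW.
move=> /forallNP nB.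
(* Each move [F] has a refuting answer [w] and, by induction, a tree for [x + w]. The weak limit of
   the roots of these trees is the new root. *)
have stepE F : exists p : (Y -> R) * Y, [/\ polar F p.1, `|p.2| <= 1 &
    forall P, forceable k P -> exists2 zs, P zs &
      [/\ size zs = k, `|p.2 + \sum_(z <- zs) z| <= 1 + k%:R * d,
      c - (x p.2 + p.1 p.2) - k%:R * d <= \sum_(z <- zs) `|z| &
      forall z, z \in zs -> `|z| <= 3]].
  have /existsNP[w /not_implyP[Fw nBw]] := nB F.
  have bxw : bounded_form (fun y => x y + 1 * w y).
    have -> : (fun y => x y + 1 * w y) = fun y => x y - (-1) * w y.
      by apply/funext => y; rewrite mulN1r opprK mul1r.
    by apply: bounded_formB => //; exact: dual_ball_bounded Fw.1.
  have [y y1 yP] := IH _ c bxw nBw; exists (w, y); split=> // P /yP.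
  by rewrite mul1r.
have [g gP] := boolp.choice stepE.
have [U UU UF] := finset_ultrafilter; have PU : ProperFilter U by exact: ultra_proper.
have g1 F : `|(g F).2| <= 1 by have [] := gP F.
have [y yw] := weak_ultralimit refl UU g1.
(* One round costs at most three errors of size [t]: from the correction [S], from [x (u - y)] and
   from [w y]. *)
have [t t0 dE] : exists2 t : R, 0 < t & d = 4 * t.
  by exists (d / 4); rewrite ?divr_gt0 //; lra.
have y1 : `|y| <= 1.
  have [f bf <-] := norming_form y; rewrite leNgt; apply/negP => fy.
  have e0 : 0 < f y - 1 by rewrite subr_gt0.
  have /cvgrPdist_lt /(_ _ e0) := yw f (dual_ball_bounded bf).
  move=> /filter_ex[F /=]; rewrite ltr_norml => /andP[_].
  have := g1 F; have := bf.2 (g F).2; have := ler_norm (f (g F).2); lra.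
exists y => // P [fs bfs fsP].
have [s bs sK] := kernel_projection bfs.
have FU : Filter U by exact: filter_filter.
have h1 := weak_small_sum FU bs yw t0.
have /cvgrPdist_lt /(_ _ t0) h2 := yw x bx.
have [F /= [[F1 F2] F3]] := filter_ex (filterI (filterI h1 h2) (UF (t^-1 *: y))).
have [Fw _ FP] := gP F; move: (g F).1 (g F).2 (g1 F) Fw FP F1 F2 => w u u1 Fw FP F1 F2.
set S := \sum_(p <- s) _ in F1.
(* The first vector of the branch is [u - y], moved into player I's kernel by [S]. Its length is
   nearly [w u], or more, because [w] lies in the dual ball and is small at [y]. *)
have kz := sK (u - y); have [zs Pzs [szs zs1 zs2 zs3]] := FP _ (fsP _ kz).
have hz : `|u - y - S| <= `|u - y| + `|S| := ler_normB _ _.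
have hz' : `|u - y| <= `|u - y - S| + `|S| by rewrite -{1}(subrK S (u - y)) ler_normD.
exists ((u - y - S) :: zs) => //; split.
- by rewrite /= szs.
- rewrite big_cons addrA.
  have -> : y + (u - y - S) + \sum_(z <- zs) z = (u + \sum_(z <- zs) z) - S.
    by rewrite [y + _]addrA subrKC addrAC.
  apply: le_trans (ler_normB _ _) _; rewrite -natr1 mulrDl; lra.
- rewrite big_cons -natr1 mulrDl.
  have wy : `|w y| <= t.
    have := Fw.2 _ F3; rewrite (linear_formZ _ _ Fw.1.1).
    by rewrite normrM gtr0_norm ?invr_gt0 // ler_pdivrMl // mulr1.
  have := Fw.1.2 (u - y); rewrite (linear_formB _ _ Fw.1.1).
  move: wy F2; rewrite !ler_norml !ltr_norml => /andP[? ?] /andP[? ?] /andP[? ?]; lra.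
- move=> z; rewrite inE => /predU1P[->|/zs3 //].
  have := ler_normB u y; lra.
Qed.

Lemma dual_bounded_exists : reflexive_space Y ->
  (forall e : R, 0 < e -> exists2 b, 0 < b & forall n, @forceable R Y n (fun zs =>
    (forall z, z \in zs -> `|z| <= 3) -> `|\sum_(z <- zs) z| <= 3 ->
    b * \sum_(z <- zs) (`|z| - e) <= 1)) ->
  forall e : R, 0 < e -> exists2 n, (0 < n)%N & dual_bounded 1 n (fun=> 0) (e * n%:R).
Proof.
move=> refl growth e e0; have e4 : 0 < e / 4 by lra.
have [b b0 bP] := growth _ e4.
(* A branch has total length at least [e n - d n]. Subtracting [n * (e / 4)] leaves at least
   [e n / 2], and [b] times that must exceed 1. *)
pose n := (Num.truncn (2 / (b * e))).+1.
have nb : 2 < b * e * n%:R.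
  by rewrite mulrC -ltr_pdivrMr ?mulr_gt0 //; exact: truncnS_gt.
have n0 : 0 < n%:R :> R by rewrite ltr0n.
exists n => //; apply: contrapT => nD.
(* [n d <= 1] keeps the sum of a branch within norm 3, and [d <= e / 4] costs at most a quarter of
   its length. *)
pose d := Num.min (e / 4) n%:R^-1.
have d0 : 0 < d by rewrite lt_min e4 invr_gt0.
have dn : n%:R * d <= 1 by rewrite -ler_pdivlMl // mulr1 ge_min lexx orbT.
have de : d <= e / 4 by rewrite ge_min lexx.
have d1 : 0 < d <= 1.
  rewrite d0 /=; apply: le_trans (_ : n%:R * d <= _) => //.
  by rewrite ler_peMl ?ler1n // ltW.
have b0' : @bounded_form R Y (fun=> 0).
  by apply: dual_ball_bounded; exact: dual_ball0.
have [y y1 yP] := dual_tree refl d1 b0' nD.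
have [zs h [szs zs1 zs2 zs3]] := yP _ (bP n).
have hS : `|\sum_(z <- zs) z| <= 3.
  have := ler_normB (y + \sum_(z <- zs) z) y; rewrite addrAC subrr add0r; lra.
have := h zs3 hS; rewrite big_split sumrN /= big_const_seq count_predT szs iter_addr_0.
have : n%:R * d <= n%:R * (e / 4) by rewrite ler_pM2l.
rewrite -mulr_natr.
set A := \sum_(z <- zs) _ in zs2 *; set m := n%:R in nb n0 zs2 * => hd hb.
have : b * (e * m / 2) <= b * (A - e / 4 * m) by rewrite ler_pM2l //; lra.
move: hb nb; rewrite -mulr_natr; lra.
Qed.

End DualGame.

(** * Growth of sums under midpoint convexity and unconditionality *)

Section Growth.
Variables (R : realType) (Y : normedModType R).

(** An arbitrary [phi] lets this serve both moduli and removes the extended reals from the rest of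
    the proof. *)
Lemma modulus_gt0P (N : Y -> R) (phi : Y -> Y -> R) :
  (0 < ereal_inf [set ereal_sup [set ereal_inf
      [set (phi y z)%:E | z in sphere N Z] | Z in @cof R Y] | y in sphere N setT] - 1)%E <->
  exists2 d, 0 < d & forall y, N y = 1 -> exists2 Z, cof Z &
    forall z, Z z -> N z = 1 -> 1 + d <= phi y z.
Proof.
rewrite sube_gt0; set X := ereal_inf _; split=> [X1|[d d0 h]]; last first.
  apply: lt_le_trans (_ : ((1 + d)%:E <= X)%E); first by rewrite lte_fin ltrDl.
  apply: le_ereal_inf_tmp => _ [y [_ Ny] <-]; have [Z cZ hZ] := h y Ny.
  apply: le_trans (ereal_sup_ubound _); last by exists Z.
  by apply: le_ereal_inf_tmp => _ [z [Zz Nz] <-]; rewrite lee_fin; exact: hZ.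
have [d d0 dX] : exists2 d : R, 0 < d & ((1 + d)%:E < X)%E.
  case: X X1 => [r| |] //=; last by exists 1; rewrite ?ltry.
  by rewrite lte_fin => r1; exists ((r - 1) / 2); rewrite ?lte_fin; lra.
exists d => // y Ny.
have : ((1 + d)%:E < ereal_sup [set ereal_inf
    [set (phi y z)%:E | z in sphere N Z] | Z in @cof R Y])%E.
  by apply: lt_le_trans dX _; apply: ereal_inf_lbound; exists y.
move=> /ereal_sup_gt[_ [Z cZ <-] hZ]; exists Z => // z Zz Nz.
by rewrite -lee_fin; apply: le_trans (ltW hZ) _; apply: ereal_inf_lbound; exists z.
Qed.

Variable N : Y -> R.
Hypothesis ND : forall x y, N (x + y) <= N x + N y.
Hypothesis NZ : forall (a : R) x, N (a *: x) = `|a| * N x.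

(** Convexity of [N]: the shorter vectors give points of the segment from [s - z] to [s + z]. *)
Lemma seminorm_max_mono s z r : 0 <= r <= 1 ->
  Num.max (N (s + r *: z)) (N (s - r *: z)) <= Num.max (N (s + z)) (N (s - z)).
Proof.
have key r' : - 1 <= r' <= 1 ->
    N (s + r' *: z) <= Num.max (N (s + z)) (N (s - z)).
  move=> /andP[r1 r2].
  have -> : s + r' *: z = ((1 + r') / 2) *: (s + z) + ((1 - r') / 2) *: (s - z).
    rewrite !scalerDr addrACA -scalerDl scalerN -scalerBl.
    have -> : (1 + r') / 2 + (1 - r') / 2 = 1 by lra.
    by have -> : (1 + r') / 2 - (1 - r') / 2 = r' by [lra]; rewrite scale1r.
  apply: le_trans (ND _ _) _; rewrite !NZ !ger0_norm; try lra.
  set m := Num.max _ _.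
  have h1 : (1 + r') / 2 * N (s + z) <= (1 + r') / 2 * m.
    by rewrite ler_wpM2l ?le_max ?lexx //; lra.
  have h2 : (1 - r') / 2 * N (s - z) <= (1 - r') / 2 * m.
    by rewrite ler_wpM2l ?le_max ?lexx ?orbT //; lra.
  lra.
move=> /andP[r0 r1]; rewrite ge_max key ?r1 ?andbT /=; last lra.
by rewrite -scaleNr key //; lra.
Qed.

Hypothesis amucN : asymptotically_midpoint_uniformly_convex N.

(** The modulus, known at unit vectors and one fixed [t], is rescaled to all [s] with [N s <= M].
    Vectors shorter than [e] need no gain. *)
Lemma amuc_step (c e M : R) : 0 < c -> 0 < e -> (forall x, c * `|x| <= N x) ->
  exists2 a, 0 < a & forall s, N s <= M -> exists2 fs, bounded_forms fs &
    forall z, kernel fs z -> `|z| <= 3 ->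
      N s + a * (`|z| - e) <= Num.max (N (s + z)) (N (s - z)).
Proof.
move=> c0 e0 cN; pose e' := c * e; have e'0 : 0 < e' by rewrite mulr_gt0.
pose M' := Num.max M 1; have M'0 : 0 < M' by rewrite lt_max ltr01 orbT.
pose t := Num.min (e' / M') 2^-1.
have t0 : 0 < t by rewrite lt_min divr_gt0 // invr_gt0 ltr0n.
have t1 : t < 1 by rewrite gt_min; apply/orP; right; lra.
have t01 : 0 < t < 1 by rewrite t0.
have [d d0 dP] := (modulus_gt0P _ _).1 (amucN t01).
pose k := Num.min (e' / 2) (e' / 2 * d).
have e2 : 0 < e' / 2 by lra.
have k0 : 0 < k by rewrite lt_min e2 mulr_gt0.
have kstep s : N s <= M -> exists2 fs, bounded_forms fs &
    forall z, kernel fs z -> e <= `|z| -> N s + k <= Num.max (N (s + z)) (N (s - z)).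
  move=> sM; have Nz z : e <= `|z| -> e' <= N z.
    by move=> ez; apply: le_trans (cN z); rewrite ler_pM2l.
  have [se|se] := ltP (N s) (e' / 2).
    (* Near the origin the triangle inequality suffices: the maximum is at least [N z], which
       exceeds [N s] by [e' / 2]. *)
    exists [::] => // z _ /Nz ez.
    have ke : k <= e' / 2 by rewrite ge_min lexx.
    have := ND (s + z) (- (s - z)); rewrite opprB.
    have -> : s + z + (z - s) = 2 *: z.
      by rewrite addrC addrA subrK scaler_nat.
    rewrite -[z - s]opprB -scaleN1r !NZ normrN1 mul1r ger0_norm // => h.
    rewrite le_max; case: (leP (N s + k) (N (s + z))) => //= h'; lra.
  have s0 : 0 < N s by lra.
  have N1 x : 0 < N x -> N ((N x)^-1 *: x) = 1.
    by move=> x0; rewrite NZ normfV gtr0_norm // mulVf // gt_eqF.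
  have [Z cZ ZP] := dP _ (N1 s s0).
  have [fs bfs fsZ] := cof_supkernel cZ; exists fs => // z kz /Nz ez.
  have z0 : 0 < N z by lra.
  have Zz : Z ((N z)^-1 *: z) by apply: submodZ; [case: cZ|exact: fsZ].
  (* After division by [N s], the vector [r *: z] has length exactly [t]. The choice of [t] ensures
     [r <= 1], so passing from [r *: z] back to [z] only helps. *)
  have h := ZP _ Zz (N1 z z0); pose r := t * N s / N z.
  have r0 : 0 <= r by rewrite divr_ge0 ?mulr_ge0 // ltW.
  have r1 : r <= 1.
    rewrite ler_pdivrMr // mul1r; apply: le_trans ez.
    apply: le_trans (_ : e' / M' * M' <= _); last by rewrite divfK // gt_eqF.
    apply: ler_pM => //; [exact: ltW|exact: ltW|by rewrite ge_min lexx|].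
    by rewrite le_max sM.
  have r01 : 0 <= r <= 1 by rewrite r0.
  apply: le_trans (seminorm_max_mono s z r01).
  have sc b : N (s + (b * r) *: z) = N s * N ((N s)^-1 *: s + (b * t) *: ((N z)^-1 *: z)).
    have -> x : N s * N x = N (N s *: x) by rewrite NZ gtr0_norm.
    rewrite scalerDr !scalerA divff ?gt_eqF // scale1r.
    by congr (N (_ + _ *: _)); rewrite /r; lra.
  have := sc 1; have := sc (-1); rewrite !mulN1r !mul1r !scaleNr => -> ->.
  rewrite -maxr_pMr; last exact: ltW.
  apply: le_trans (_ : N s * (1 + d) <= _); last by rewrite ler_pM2l.
  rewrite mulrDr mulr1 lerD2l; apply: le_trans (_ : e' / 2 * d <= _).
    by rewrite ge_min lexx orbT.
  by rewrite ler_wpM2r // ltW.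
(* Since [|z| <= 3], the fixed gain [k] dominates a gain of slope [k / 3]. *)
exists (k / 3) => [|s sM]; first by rewrite divr_gt0.
have [fs bfs fsP] := kstep s sM; exists fs => // z kz z3.
have [ze|ze] := leP e `|z|.
  apply: le_trans (fsP z kz ze); rewrite lerD2l.
  have : k * (`|z| - e) <= k * 3 by rewrite ler_pM2l //; lra.
  lra.
apply: le_trans (seminorm_max_ge ND NZ s z); rewrite gerDl.
by rewrite pmulr_rle0 ?divr_gt0 // subr_le0 ltW.
Qed.

Lemma unconditional_growth :
  (forall Z : set Y, cof Z -> sphere Num.norm Z !=set0) ->
  unconditional_asymptotic_structure Y ->
  (exists c C, [/\ 0 < c, 0 < C & forall x, c * `|x| <= N x <= C * `|x|]) ->
  forall e : R, 0 < e -> exists2 b, 0 < b & forall n, @forceable R Y n (fun zs =>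
    (forall z, z \in zs -> `|z| <= 3) -> `|\sum_(z <- zs) z| <= 3 ->
    b * \sum_(z <- zs) (`|z| - e) <= 1).
Proof.
move=> infY [K [K1 uas]] [c [C [c0 C0 cNC]]] e e0.
pose B := C * (K * 3); have B0 : 0 < B by rewrite !mulr_gt0 //; lra.
have cN x : c * `|x| <= N x by have /andP[] := cNC x.
have NC x : N x <= C * `|x| by have /andP[] := cNC x.
(* Unconditionality bounds every signed sum by [B] in [N], so the threshold [B + 1] is never
   reached. *)
have [a a0 step] := amuc_step (B + 1) c0 e0 cN.
exists (a / B) => [|n]; first by rewrite divr_gt0.
apply: forceable_mono (forceable_and (unconditional_forceable infY (uas n))
  (growth_forceable ND NZ n 0 step)) => zs _ [unc grow] z3 S3.
have [v sv] := grow z3; rewrite !add0r => Nv.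
have vB : N v <= B.
  apply: le_trans (NC v) _; rewrite ler_pM2l //.
  apply: le_trans (unc v sv) _; rewrite ler_pM2l //; lra.
have N0 : N 0 = 0 by rewrite -[0](scale0r (0 : Y)) NZ normr0 mul0r.
rewrite mulrAC ler_pdivrMr // mul1r; case: Nv; lra.
Qed.

End Growth.

(** * Smoothing the dual ball *)

Section DualBalls.
Variables (R : realType) (Y : normedModType R).

Lemma polarN (F : seq Y) (w : Y -> R) : polar F w -> polar F (fun y => - w y).
Proof.
move=> [[lw w1] wF]; split; last by move=> v /wF; rewrite normrN.
by split=> [a x y|y]; [rewrite lw; lra|rewrite normrN].
Qed.

Lemma dual_bounded_norm t k (x : Y -> R) c :
  dual_bounded t k x c -> forall y, `|x y| <= c * `|y|.
Proof.
elim: k x => [//|k IH] x /= [F /(_ _ (polar0 F))/IH h] y.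
by have := h y; rewrite mulr0 addr0.
Qed.

(** Player I plays both strategies at once; the same answer enters both games, and [a + b = 1] keeps
    its coefficient [t]. *)
Lemma dual_bounded_convex t k (x x' : Y -> R) c c' a b : 0 <= a -> 0 <= b -> a + b = 1 ->
  dual_bounded t k x c -> dual_bounded t k x' c' ->
  dual_bounded t k (fun y => a * x y + b * x' y) (a * c + b * c').
Proof.
move=> a0 b0 ab; elim: k x x' => [|k IH] x x' /=.
  move=> h h' y; apply: le_trans (ler_normD _ _) _.
  by rewrite !normrM (ger0_norm a0) (ger0_norm b0) mulrDl -!mulrA lerD // ler_wpM2l.
move=> [F FP] [F' FP']; exists (F ++ F') => w /polar_cat[/FP h /FP' h'].
have := IH _ _ h h'; congr (dual_bounded _ _ _ _); apply/funext => y.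
by rewrite !mulrDr addrACA -mulrDl ab mul1r.
Qed.

Lemma dual_bounded_opp t k (x : Y -> R) c :
  dual_bounded t k x c -> dual_bounded t k (fun y => - x y) c.
Proof.
elim: k x => [|k IH] x /=; first by move=> h y; rewrite normrN.
move=> [F FP]; exists F => w /polarN/FP/IH.
by congr (dual_bounded _ _ _ _); apply/funext => y; lra.
Qed.

Lemma dual_bounded_steps t k (x : Y -> R) c : 0 <= t ->
  (forall y, `|x y| <= c * `|y|) -> dual_bounded t k x (c + t * k%:R).
Proof.
move=> t0; elim: k x c => [|k IH] x c h /=; first by rewrite mulr0 addr0.
exists [::] => w [[_ w1] _].
have -> : c + t * k.+1%:R = (c + t) + t * k%:R by rewrite -natr1; lra.
apply: IH => y; apply: le_trans (ler_normD _ _) _.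
by rewrite mulrDl lerD // normrM (ger0_norm t0) ler_wpM2l.
Qed.

Lemma dual_bounded_shift t n (x u : Y -> R) c c' : 0 <= t ->
  (forall y, `|x y| <= c * `|y|) -> dual_bounded 1 n u c' ->
  dual_bounded t n (fun y => x y + t * u y) (c + t * c').
Proof.
move=> t0 h; elim: n u => [|n IH] u /=.
  move=> h' y; apply: le_trans (ler_normD _ _) _.
  by rewrite mulrDl lerD // normrM (ger0_norm t0) -mulrA ler_wpM2l.
move=> [F FP]; exists F => w /FP/IH.
by congr (dual_bounded _ _ _ _); apply/funext => y; lra.
Qed.

(* Sublevel set of the average over [k < n] of the values of the [k]-step games
   started at [x]: one more move of the game telescopes this average. *)
Definition smooth_ball (t : R) (n : nat) (x : Y -> R) : Prop :=
  linear_form x /\ exists2 c : nat -> R,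
    forall k, (k < n)%N -> dual_bounded t k x (c k) &
    \sum_(k < n) c k <= 2 * n%:R.

Lemma smooth_ball_dual_ball t n x : 0 <= t -> t * n%:R <= 1 -> dual_ball x ->
  smooth_ball t n x.
Proof.
move=> t0 tn [lx x1]; split=> //; exists (fun k => 1 + t * k%:R).
  by move=> k _; apply: dual_bounded_steps => // y; rewrite mul1r.
apply: le_trans (_ : \sum_(k < n) 2 <= _); last first.
  by rewrite sumr_const card_ord mulr_natr.
apply: ler_sum => k _; rewrite [leRHS](_ : 2 = 1 + 1) // lerD2l.
by apply: le_trans tn; rewrite ler_wpM2l // ler_nat ltnW.
Qed.

(** The answer 0 is always allowed, so every game value dominates the norm of [x]. *)
Lemma smooth_ball_le t n x y : (0 < n)%N -> smooth_ball t n x -> `|x y| <= 2 * `|y|.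
Proof.
move=> n0 [_ [c cP cn]]; have n0' : 0 < n%:R :> R by rewrite ltr0n.
rewrite -(ler_pM2l n0'); apply: le_trans (_ : (\sum_(k < n) c k) * `|y| <= _).
  rewrite mulr_suml mulr_natl -[X in _ *+ X](card_ord n) -sumr_const.
  by apply: ler_sum => k _; exact: dual_bounded_norm (cP k (ltn_ord k)) y.
by rewrite mulrA [_ * 2]mulrC ler_wpM2r.
Qed.

Lemma smooth_ball_opp t n x : smooth_ball t n x -> smooth_ball t n (fun y => - x y).
Proof.
move=> [lx [c cP cn]]; split; first by move=> a u v; rewrite lx; lra.
by exists c => // k kn; exact/dual_bounded_opp/cP.
Qed.

Lemma polar_flatten (Fs : seq (seq Y)) F w : F \in Fs -> polar (flatten Fs) w -> polar F w.
Proof.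
move=> FFs [bw h]; split=> // v vF; apply: h.
by apply/flattenP; exists F.
Qed.

(** Summing the values, the move replaces [c 0] by a last term of at most [c 0 + t e n], so their
    average rises by at most [t e]. A convex combination with the zero functional, whose average is
    at most 1, brings it back to 2. *)
Lemma smooth_ball_step t e n x : 0 <= t -> 0 <= e -> t * n%:R <= 1 -> (0 < n)%N ->
  @dual_bounded R Y 1 n (fun=> 0) (e * n%:R) -> smooth_ball t n x ->
  exists F : seq Y, forall w, polar F w ->
    smooth_ball t n (fun y => (1 + t * e)^-1 * (x y + t * w y)).
Proof.
move=> t0 e0; case: n => // n tn _ D [lx [c cP cn]].
(* After the move, the [k]-step value is at most the former [k.+1]-step one. The last value comes
   from playing [D] from [x], whose norm is at most [c 0]. *)
pose c' k := if (k < n)%N then c k.+1 else c 0%N + t * (e * n.+1%:R).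
have FE k : exists F : seq Y, (k < n.+1)%N -> forall w, polar F w ->
    dual_bounded t k (fun y => x y + t * w y) (c' k).
  have [kn|kn] := ltnP k n.+1; last by exists [::].
  move: kn; rewrite ltnS leq_eqVlt /c' => /predU1P[->|kn]; last first.
    by have [F FP] := cP k.+1 kn; exists F => _ w /FP; rewrite kn.
  have := dual_bounded_shift t0 (cP 0%N isT) D.
  under [fun y => _]eq_fun do rewrite mulr0 addr0.
  by move=> [F FP]; exists F => _ w /FP; rewrite ltnn.
have [F FP] := boolp.choice FE.
exists (flatten [seq F k | k <- iota 0 n.+1]) => w Fw.
have [lw _] := Fw.1.
have te : 0 < 1 + t * e by rewrite ltr_pwDl // mulr_ge0.
set s := (1 + t * e)^-1; have s0 : 0 < s by rewrite invr_gt0.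
have s1 : s <= 1 by rewrite invf_le1 // lerDl mulr_ge0.
have ste : s * (1 + t * e) = 1 by rewrite mulVf // gt_eqF.
split; first by move=> a u v; rewrite lx lw; lra.
exists (fun k => s * c' k + (1 - s) * (0 + t * k%:R)).
  move=> k kn; have Fk : polar (F k) w.
    by apply: polar_flatten Fw; apply: map_f; rewrite mem_iota.
  have z0 : @dual_bounded R Y t k (fun=> 0) (0 + t * k%:R).
    by apply: dual_bounded_steps => // y; rewrite normr0 mul0r.
  have := dual_bounded_convex (ltW s0) _ _ (FP k kn w Fk) z0.
  move=> /(_ (1 - s)) h; have := h _ _.
  rewrite subr_ge0 s1 addrC subrK => /(_ isT erefl).
  by congr (dual_bounded _ _ _ _); apply/funext => y; rewrite mulr0 addr0.
rewrite big_split -!mulr_sumr /=.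
have c'E : \sum_(k < n.+1) c' k = \sum_(k < n.+1) c k + t * (e * n.+1%:R).
  rewrite big_ord_recr [in RHS]big_ord_recl /=.
  have -> : c' n = c 0%N + t * (e * n.+1%:R) by rewrite /c' ltnn.
  have -> : \sum_(k < n) c' k = \sum_(k < n) c (lift ord0 k).
    by apply: eq_bigr => k _; rewrite /c' ltn_ord.
  by rewrite addrCA addrA.
have tk : \sum_(k < n.+1) (0 + t * k%:R) <= n.+1%:R.
  rewrite -[leRHS]mul1r mulr_natr -[X in _ *+ X](card_ord n.+1) -sumr_const.
  apply: ler_sum => k _; rewrite add0r; apply: le_trans tn.
  by rewrite ler_wpM2l // ler_nat ltnW.
have h1 : (1 - s) * \sum_(k < n.+1) (0 + t * k%:R) <= (1 - s) * n.+1%:R.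
  by rewrite ler_wpM2l // subr_ge0.
have h2 : s * \sum_(k < n.+1) c' k <= s * (2 * n.+1%:R + t * (e * n.+1%:R)).
  by rewrite ler_pM2l // c'E lerD2r.
have h3 : s * (1 + t * e) * n.+1%:R = n.+1%:R by rewrite ste mul1r.
lra.
Qed.

(** The set is a smooth ball with [t = 1 / n]. Moving [x] by [t w] gains at least [t r / 8] at
    [y + z], and the normalising factor loses only part of that. Set and gain form a pair so that a
    sequence of them can be chosen. *)
Lemma separating_ball (r : R) :
  (forall e : R, 0 < e ->
     exists2 n, (0 < n)%N & @dual_bounded R Y 1 n (fun=> 0) (e * n%:R)) ->
  0 < r <= 1 ->
  exists p : ((Y -> R) -> Prop) * R, [/\ 0 < p.2,
    forall x, dual_ball x -> p.1 x,
    forall x, p.1 x -> linear_form x /\ forall y, `|x y| <= 2 * `|y|,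
    forall x, p.1 x -> p.1 (fun y => - x y) &
    forall x y, p.1 x -> `|y| <= 2 -> exists2 fs, bounded_forms fs &
      forall z, kernel fs z -> r <= `|z| ->
        exists2 x', p.1 x' & x y + p.2 <= x' (y + z)].
Proof.
move=> D /andP[r0 r1]; have e0 : 0 < r / 64 by lra.
have [n n0 nD] := D _ e0; have n0' : 0 < n%:R :> R by rewrite ltr0n.
pose t : R := n%:R^-1; have t0 : 0 < t by rewrite invr_gt0.
have t1 : t <= 1 by rewrite invf_le1 // ler1n.
have tn : t * n%:R <= 1 by rewrite mulVf // gt_eqF.
exists (smooth_ball t n, t * r / 32); split => /=.
- by rewrite divr_gt0 // mulr_gt0.
- by move=> x; apply: smooth_ball_dual_ball => //; exact: ltW.
- by move=> x Kx; split; [case: Kx|move=> y; exact: smooth_ball_le Kx].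
- exact: smooth_ball_opp.
move=> x y Kx y2.
have [F FP] := smooth_ball_step (ltW t0) (ltW e0) tn n0 nD Kx.
(* The extra point forces [|w y| <= r / 8], against [w z >= r / 4]. *)
have [fs bfs fsP] := polar_large (((8 / r) *: y) :: F).
have bx : bounded_form x.
  by split; [case: Kx|exists 2 => u; exact: smooth_ball_le Kx].
exists (x :: fs); first exact: bounded_forms_cons.
move=> z /kernel_cons[xz /fsP[w [bw wF] wz]] rz.
have {}FP := FP w (conj bw (fun v vF => wF v (mem_behead (s := _ :: F) vF))).
exists (fun y => (1 + t * (r / 64))^-1 * (x y + t * w y)) => //.
have wy : `|w y| <= r / 8.
  have := wF _ (mem_head _ _); rewrite (linear_formZ _ _ bw.1) normrM.
  rewrite gtr0_norm ?divr_gt0 // -ler_pdivlMl ?divr_gt0 // invf_div mulr1 //.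
have te : 0 < 1 + t * (r / 64) by rewrite ltr_pwDl // mulr_ge0 // ltW.
rewrite ler_pdivlMl // (linear_formD _ _ bx.1) (linear_formD _ _ bw.1) xz.
have xy : x y <= 4.
  have := smooth_ball_le y n0 Kx; have := ler_norm (x y); lra.
have wy' : - (r / 8) <= w y by move: wy; rewrite ler_norml => /andP[].
have h1 : t * (r / 8) <= t * (w y + w z) .
  rewrite ler_pM2l //; lra.
have h2 : t * r * x y <= t * r * 4 by rewrite ler_pM2l // mulr_gt0.
have h3 : t * r * (t * r) <= t * r * 1.
  rewrite ler_pM2l ?mulr_gt0 //; apply: le_trans (_ : t * 1 <= _); last lra.
  by rewrite ler_pM2l.
have tr : 0 < t * r by rewrite mulr_gt0.
lra.
Qed.

End DualBalls.

(** * Weighted sums of norms *)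

Section SupNorm.
Variables (R : realType) (Y : normedModType R).

Lemma sum_half (J : nat) : \sum_(j < J) (2^-1 : R) ^+ j.+1 = 1 - 2^-1 ^+ J.
Proof.
elim: J => [|J IH]; first by rewrite big_ord0 expr0 subrr.
by rewrite big_ord_recr /= IH exprS; lra.
Qed.

Variable A : nat -> (Y -> R) -> Prop.
Hypothesis A1 : forall j x, dual_ball x -> A j x.
Hypothesis A2 : forall j x, A j x -> linear_form x /\ forall y, `|x y| <= 2 * `|y|.
Hypothesis AN : forall j x, A j x -> A j (fun y => - x y).

Definition weighted_form (X : nat -> Y -> R) (J : nat) (y : Y) : R :=
  \sum_(j < J) 2^-1 ^+ j.+1 * X j y.

Definition weighted_values (y : Y) : set R :=
  [set r | exists X J, (forall j, A j (X j)) /\ r = weighted_form X J y].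

(** This is the series of the support functions of the [A j] with weights [2^-(j+1)]; finite
    truncations avoid summing it. *)
Definition weighted_norm (y : Y) : R := sup (weighted_values y).

Lemma weighted_form_le X J y : (forall j, A j (X j)) ->
  weighted_form X J y <= 2 * `|y|.
Proof.
move=> AX; apply: le_trans (_ : \sum_(j < J) 2^-1 ^+ j.+1 * (2 * `|y|) <= _).
  apply: ler_sum => j _; rewrite ler_pM2l ?exprn_gt0 ?invr_gt0 //.
  exact: le_trans (ler_norm _) ((A2 (AX j)).2 y).
by rewrite -mulr_suml sum_half ler_piMl ?mulr_ge0 // gerBl exprn_ge0 // invr_ge0.
Qed.

Lemma weighted_norm_ub X J y : (forall j, A j (X j)) ->
  weighted_form X J y <= weighted_norm y.
Proof.
move=> AX; apply: ub_le_sup; last by exists X, J.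
by exists (2 * `|y|) => _ [X' [J' [AX' ->]]]; exact: weighted_form_le.
Qed.

Lemma weighted_norm_le y r :
  (forall X J, (forall j, A j (X j)) -> weighted_form X J y <= r) ->
  weighted_norm y <= r.
Proof.
move=> h; apply: ge_sup; last by move=> _ [X [J [AX ->]]]; exact: h.
exists (weighted_form (fun _ _ => 0) 0 y), (fun _ _ => 0), 0%N; split=> // j.
by apply: A1; exact: dual_ball0.
Qed.

Lemma weighted_norm_half y : 2^-1 * `|y| <= weighted_norm y.
Proof.
have [f f1 <-] := norming_form y.
apply: le_trans (@weighted_norm_ub (fun=> f) 1 y _); last by move=> j; exact: A1.
by rewrite /weighted_form big_ord1 expr1.
Qed.

Lemma weighted_norm_equivalent : equivalent_norm weighted_norm.
Proof.
have Zle a x : weighted_norm (a *: x) <= `|a| * weighted_norm x.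
  apply: weighted_norm_le => X J AX; have [a0|a0] := leP 0 a.
    apply: le_trans (_ : a * weighted_form X J x <= _); last first.
      by rewrite ger0_norm // ler_wpM2l // weighted_norm_ub.
    rewrite mulr_sumr; apply: ler_sum => j _.
    by rewrite (linear_formZ _ _ (A2 (AX j)).1) mulrCA.
  apply: le_trans (_ : - a * weighted_form (fun j y => - X j y) J x <= _).
    rewrite mulr_sumr; apply: ler_sum => j _.
    by rewrite (linear_formZ _ _ (A2 (AX j)).1) mulrN mulrNN mulrCA.
  rewrite ltr0_norm //; apply: ler_wpM2l; first by rewrite oppr_ge0 ltW.
  by apply: weighted_norm_ub => j; exact: AN.
split.
- move=> x y; apply: weighted_norm_le => X J AX.
  rewrite /weighted_form; under eq_bigr do
    rewrite (linear_formD _ _ (A2 (AX _)).1) mulrDr.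
  by rewrite big_split; apply: lerD; exact: weighted_norm_ub.
- move=> a x; apply/eqP; rewrite eq_le Zle /=.
  have [->|a0] := eqVneq a 0.
    rewrite normr0 mul0r; apply: le_trans (weighted_norm_half _).
    by rewrite mulr_ge0 // invr_ge0.
  rewrite -ler_pdivlMl ?normr_gt0 // -normfV.
  by have := Zle a^-1 (a *: x); rewrite scalerA mulVf // scale1r.
- exists 2^-1, 2; split=> // x; rewrite weighted_norm_half /=.
  by apply: weighted_norm_le => X J; exact: weighted_form_le.
Qed.

Lemma weighted_form_extend X J K y : (forall j, A j (X j)) ->
  exists2 X', forall j, A j (X' j) & weighted_form X' (J + K) y = weighted_form X J y.
Proof.
move=> AX; exists (fun j => if (j < J)%N then X j else (fun=> 0)).
  by move=> j; case: ifP => _ //; apply: A1; exact: dual_ball0.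
rewrite /weighted_form [RHS](big_ord_widen _ (fun j => 2^-1 ^+ j.+1 * X j y) (leq_addr K J)).
rewrite [RHS]big_mkcond; apply: eq_bigr => j _; case: ifP => //.
by rewrite mulr0.
Qed.

(** In a nearly norming family for [y], only the [k]-th functional is replaced, by one gaining [q k]
    at [y + t *: z]. The others vanish at [z], which lies in their kernels. *)
Lemma weighted_norm_auc (q r : nat -> R) :
  (forall j, 0 < q j) -> (forall e, 0 < e -> exists k, r k <= e) ->
  (forall j x y, A j x -> `|y| <= 2 -> exists2 fs, bounded_forms fs &
    forall z, kernel fs z -> r j <= `|z| ->
      exists2 x', A j x' & x y + q j <= x' (y + z)) ->
  asymptotically_uniformly_convex weighted_norm.
Proof.
move=> q0 rP AP t /andP[t0 t1]; apply/modulus_gt0P.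
have t2 : 0 < t / 2 by lra.
have [k rk] := rP _ t2.
have wk : 0 < 2^-1 ^+ k.+1 * q k by rewrite mulr_gt0 // exprn_gt0 // invr_gt0.
(* Half of the gain pays for the family being only nearly norming. *)
exists (2^-1 ^+ k.+1 * q k / 2) => [|y Ny]; first by rewrite divr_gt0.
set d := _ / 2; have d0 : 0 < d by rewrite divr_gt0.
have y2 : `|y| <= 2 by have := weighted_norm_half y; rewrite Ny; lra.
have [X [J [AX XJ]]] : exists X J, (forall j, A j (X j)) /\
    1 - d < weighted_form X J y.
  apply: contrapT => h.
  have : weighted_norm y <= 1 - d.
    apply: weighted_norm_le => X J AX; rewrite leNgt; apply/negP => XJ.
    by apply: h; exists X, J.
  by rewrite Ny; lra.
(* Padding by zero functionals ensures that index [k] occurs in the truncation. *)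
have [X' AX' XE] := weighted_form_extend J k.+1 y AX; rewrite -XE in XJ.
have kJ : (k < J + k.+1)%N by rewrite addnS ltnS leq_addl.
move: (J + k.+1)%N kJ XJ => n kn Xn {X AX XE J}.
have [fs bfs fsP] := AP k (X' k) y (AX' k) y2.
have bX : bounded_forms [seq X' j | j <- iota 0 n].
  move=> _ /mapP[j _ ->]; have [lX X2] := A2 (AX' j); split => //.
  by exists 2.
exists (kernel (fs ++ [seq X' j | j <- iota 0 n])).
  by apply: cof_kernel; exact: bounded_forms_cat.
move=> z kz Nz.
have bb := bounded_forms_cat bfs bX.
have ktz : kernel (fs ++ [seq X' j | j <- iota 0 n]) (t *: z).
  exact: (submodZ (kernel_submod bb)).
have [k1 k2] := (kernel_cat _ _ _).1 ktz.
have z2 : r k <= `|t *: z|.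
  rewrite normrZ gtr0_norm //; apply: le_trans rk _; rewrite ler_pM2l //.
  have : weighted_norm z <= 2 * `|z|.
    by apply: weighted_norm_le => X J; exact: weighted_form_le.
  by rewrite Nz; lra.
have [x' Ax' hx'] := fsP _ k1 z2.
pose X'' j := if j == k then x' else X' j.
have AX'' j : A j (X'' j) by rewrite /X''; case: eqP => [->|].
apply: le_trans (weighted_norm_ub n _ AX'').
have : weighted_form X' n y + 2^-1 ^+ k.+1 * q k <= weighted_form X'' n (y + t *: z).
  rewrite /weighted_form (bigD1 (Ordinal kn)) //= [leRHS](bigD1 (Ordinal kn)) //=.
  rewrite addrAC -mulrDr; apply: lerD.
    rewrite ler_pM2l ?exprn_gt0 ?invr_gt0 //.
    by rewrite /X'' eqxx.
  apply: ler_sum => j; rewrite -val_eqE /X'' /= => /negPf ->.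
  have Xz : X' j (t *: z) = 0.
    by apply: k2; apply/mapP; exists (j : nat); rewrite // mem_iota add0n ltn_ord.
  by rewrite (linear_formD _ _ (A2 (AX' j)).1) Xz addr0.
by move: Xn; rewrite /d; lra.
Qed.

End SupNorm.

(** * Equivalence of the two renorming properties *)

Lemma equivalent_auc_norm (R : realType) (Y : normedModType R) :
  reflexive_space Y ->
  (forall e : R, 0 < e -> exists2 b, 0 < b & forall n, @forceable R Y n (fun zs =>
    (forall z, z \in zs -> `|z| <= 3) -> `|\sum_(z <- zs) z| <= 3 ->
    b * \sum_(z <- zs) (`|z| - e) <= 1)) ->
  exists N : Y -> R, equivalent_norm N /\ asymptotically_uniformly_convex N.
Proof.
move=> refl growth; pose r (j : nat) : R := j.+1%:R^-1.
have r01 j : 0 < r j <= 1 by rewrite invr_gt0 ltr0n invf_le1 ?ltr0n // ler1n.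
have [p pP] := boolp.choice
  (fun j => separating_ball (dual_bounded_exists refl growth) (r01 j)).
have A1 j x : dual_ball x -> (p j).1 x by have [_ + _ _ _] := pP j; exact.
have A2 j x : (p j).1 x -> linear_form x /\ forall y, `|x y| <= 2 * `|y|.
  by have [_ _ + _ _] := pP j; exact.
have AN j x : (p j).1 x -> (p j).1 (fun y => - x y).
  by have [_ _ _ + _] := pP j; exact.
exists (weighted_norm (fun j => (p j).1)); split.
  exact: weighted_norm_equivalent.
apply: (weighted_norm_auc A1 A2 (q := fun j => (p j).2) (r := r)).
- by move=> j; have [] := pP j.
- move=> e e0; exists (Num.truncn e^-1); rewrite /r invf_ple ?posrE ?ltr0n //.
  exact/ltW/truncnS_gt.
- by move=> j; have [_ _ _ _] := pP j.
Qed.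

Theorem corollary5p4 (R : realType) (Y : completeNormedModType R)
    (Y_separable : separable Y)
    (Y_reflexive : reflexive_space Y)
    (Y_uas : unconditional_asymptotic_structure Y) :
  (exists N : Y -> R,
      equivalent_norm N /\ asymptotically_midpoint_uniformly_convex N) <->
  (exists N : Y -> R,
      equivalent_norm N /\ asymptotically_uniformly_convex N).
Proof.
split=> [[N [eN amucN]]|[N [eN aucN]]]; last first.
  exists N; split=> // t /aucN/modulus_gt0P[d d0 dP].
  apply/modulus_gt0P; exists d => // y /dP[Z cZ ZP]; exists Z => // z Zz Nz.
  by rewrite le_max ZP.
have [ND NZ Nb] := eN.
have [infY|/existsNP[Z /not_implyP[cZ Z0]]] :=
    pselect (forall Z : set Y, cof Z -> sphere Num.norm Z !=set0).
  exact/equivalent_auc_norm/(unconditional_growth ND NZ amucN).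
(* A finite-codimensional [Z] without unit vectors contains no [z] with [N z = 1] either, so any [d]
   satisfies the condition. *)
exists N; split=> // t _; apply/modulus_gt0P; exists 1 => // y _.
exists Z => // z Zz Nz; exfalso; apply: Z0.
have z0 : `|z| != 0.
  apply/eqP => /normr0_eq0 z0; move: Nz.
  by rewrite z0 -(scale0r (0 : Y)) NZ normr0 mul0r => /esym/eqP; rewrite oner_eq0.
exists (`|z|^-1 *: z); split; last by rewrite normrZ normfV normr_id mulVf.
by apply: submodZ => //; case: cZ.
Qed.
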